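(* There is a polynomial-time $(2k^2+2)$-approximation algorithm for $k$-column-sparse packing integer programs with multiplicity constraints. That is, there is a polynomial-time algorithm which, given nonnegative rational $A$ with at most $k$ nonzero entries in each column, nonnegative rational $b,c$, and $d$ with entries in $\mathbb{Z}_{\ge0}\cup\{+\infty\}$, returns a feasible solution of $\max\{c\cdot x: Ax\le b,\ 0\le x\le d,\ x \text{ integral}\}$ whose objective value is at least $1/(2k^2+2)$ times the optimum.
   Context: A packing integer program (PIP) is an integer program $\{\max c\cdot x: Ax\le b,\ 0\le x\le d,\ x\text{ integral}\}$ with $A,b,c,d$ nonnegative and rational; the constraints $x\le d$ are multiplicity constraints, entries of $d$ may be $+\infty$, finite entries integral. It is $k$-column-sparse ($k$-CS) if each column of $A$ has at most $k$ nonzero entries. An $\alpha$-approximation algorithm for a packing problem returns a feasible solution of objective value at least $1/\alpha$ times optimal. *)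

(* Defs.v *)
From HB Require Import structures.
From mathcomp Require Import all_boot all_order all_algebra.

Set Implicit Arguments.
Unset Strict Implicit.
Unset Printing Implicit Defensive.

Import Order.TTheory GRing.Theory Num.Theory.

(* The random access machine with logarithmic cost:
   the machine of Aho, Hopcroft and Ullman (The Design and Analysis of
   Computer Algorithms, 1.2-1.3), with three-address instructions and natural
   number registers: unboundedly many registers, indirect addressing, a
   read-only input tape and a write-only output tape, where every instruction
   is charged the binary lengths of all the addresses and values that it
   handles. *)

(* l(v) = floor (log2 v) + 1 for v > 0, and l(0) = 1 *)
Definition bitlen (v : nat) : nat := (trunc_log 2 v).+1.

Definition word := seq nat.

Definition word_size (w : word) : nat := \sum_(v <- w) bitlen v.

Inductive instr : Type :=
  | Const of nat & nat          (* R[i] := v *)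
  | Add of nat & nat & nat      (* R[i] := R[j] + R[k] *)
  | Sub of nat & nat & nat      (* R[i] := max (R[j] - R[k], 0) *)
  | Mul of nat & nat & nat      (* R[i] := R[j] * R[k] *)
  | Div of nat & nat & nat      (* R[i] := floor (R[j] / R[k]), 0 if R[k] = 0 *)
  | Fetch of nat & nat          (* R[i] := R[R[j]] *)
  | Store of nat & nat          (* R[R[i]] := R[j] *)
  | Jump of nat                 (* goto l *)
  | Jzero of nat & nat          (* if R[i] = 0 goto l *)
  | Read of nat                 (* R[i] := next input, 0 if there is none *)
  | Write of nat                (* output R[i] *)
  | Halt.

Definition program := seq instr.

Record state : Type := State {
  pc : nat;
  regs : nat -> nat;
  inp : word;
  out : word
}.

Definition init_state (w : word) : state := State 0 (fun=> 0) w [::].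

Definition set_reg (s : state) (i v : nat) : state :=
  State (pc s).+1 [eta regs s with i |-> v] (inp s) (out s).

Definition goto (s : state) (l : nat) : state :=
  State l (regs s) (inp s) (out s).

(* The cost of the next instruction and the state it leads to; None when the
   machine has halted, which it also does when pc leaves the program. *)
Definition step (p : program) (s : state) : option (nat * state) :=
  let R := regs s in
  let arith i j k v :=
    Some (bitlen i + bitlen j + bitlen k + bitlen (R j) + bitlen (R k),
          set_reg s i v) in
  match nth Halt p (pc s) with
  | Const i v => Some (bitlen i + bitlen v, set_reg s i v)
  | Add i j k => arith i j k (R j + R k)
  | Sub i j k => arith i j k (R j - R k)
  | Mul i j k => arith i j k (R j * R k)
  | Div i j k => arith i j k (R j %/ R k)
  | Fetch i j =>
      Some (bitlen i + bitlen j + bitlen (R j) + bitlen (R (R j)),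
            set_reg s i (R (R j)))
  | Store i j =>
      Some (bitlen i + bitlen j + bitlen (R i) + bitlen (R j),
            set_reg s (R i) (R j))
  | Jump l => Some (bitlen l, goto s l)
  | Jzero i l =>
      Some (bitlen i + bitlen (R i) + bitlen l,
            goto s (if R i == 0 then l else (pc s).+1))
  | Read i =>
      let v := head 0 (inp s) in
      Some (bitlen i + bitlen v,
            State (pc s).+1 [eta R with i |-> v] (behead (inp s)) (out s))
  | Write i =>
      Some (bitlen i + bitlen (R i),
            State (pc s).+1 R (inp s) (rcons (out s) (R i)))
  | Halt => None
  end.

Inductive runs (p : program) : state -> nat -> state -> Prop :=
  | runs_halt s : step p s = None -> runs p s 0 s
  | runs_step s c s1 t s2 :
      step p s = Some (c, s1) -> runs p s1 t s2 -> runs p s (c + t) s2.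

Definition outputs_in (p : program) (w : word) (t : nat) (o : word) : Prop :=
  exists2 s, runs p (init_state w) t s & out s = o.

Definition outputs (p : program) (w o : word) : Prop :=
  exists t, outputs_in p w t o.

Definition polynomial_time (p : program) (D : word -> Prop) : Prop :=
  exists P : {poly nat}, forall w, D w ->
    exists t o, outputs_in p w t o /\ t <= P.[word_size w]%R.

Local Open Scope ring_scope.

(* In ubound, None stands for +oo. *)
Record pip : Type := Pip {
  nrows : nat;
  ncols : nat;
  cmat : 'M[rat]_(nrows, ncols);
  rhs : 'cV[rat]_nrows;
  obj : 'rV[rat]_ncols;
  ubound : 'I_ncols -> option nat;
  cmat_ge0 : forall i j, 0 <= cmat i j;
  rhs_ge0 : forall i, 0 <= rhs i 0;
  obj_ge0 : forall j, 0 <= obj 0 j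
}.

Arguments ubound : clear implicits.

Definition column_sparse (k : nat) (I : pip) : Prop :=
  forall j : 'I_(ncols I), (#|[set i | (cmat I i j != 0)%R]| <= k)%N.

Definition objective (I : pip) (x : 'cV[nat]_(ncols I)) : rat :=
  \sum_j obj I 0 j * (x j 0)%:R.

(* Integrality and 0 <= x are carried by the type of x. *)
Definition feasible (I : pip) (x : 'cV[nat]_(ncols I)) : Prop :=
  (forall i, \sum_j cmat I i j * (x j 0)%:R <= rhs I i 0) /\
  (forall j, if ubound I j is Some u then (x j 0%R <= u)%N else true).

Definition optimal (I : pip) (x : 'cV[nat]_(ncols I)) : Prop :=
  feasible x /\ forall y : 'cV[nat]_(ncols I),
    feasible y -> objective y <= objective x.

(* The optimum is missing exactly when the program is unbounded; then only
   feasibility is required. *)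
Definition approx_solution (alpha : rat) (I : pip) (x : 'cV[nat]_(ncols I)) :
    Prop :=
  feasible x /\
  forall y : 'cV[nat]_(ncols I),
    optimal y -> alpha^-1 * objective y <= objective x.

Definition encode_rat (q : rat) : word := [:: `|numq q|%N; `|denq q|%N].

(* +oo is written 0 and a finite bound u is written u + 1. *)
Definition encode_ubound (u : option nat) : nat :=
  if u is Some v then v.+1 else 0%N.

Definition encode_pip (I : pip) : word :=
  [:: nrows I; ncols I]
  ++ flatten [seq encode_rat (cmat I i j) | i <- enum 'I_(nrows I),
                                            j <- enum 'I_(ncols I)]
  ++ flatten [seq encode_rat (rhs I i 0) | i <- enum 'I_(nrows I)]
  ++ flatten [seq encode_rat (obj I 0 j) | j <- enum 'I_(ncols I)]
  ++ [seq encode_ubound (ubound I j) | j <- enum 'I_(ncols I)].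

Definition encode_solution (n : nat) (x : 'cV[nat]_n) : word :=
  [seq x j 0 | j <- enum 'I_n].

Definition pip_word (w : word) : Prop := exists I : pip, w = encode_pip I.

(* Main.v *)
Require Import Defs.
From mathcomp Require Import all_boot all_order all_algebra zify.

Set Implicit Arguments.
Unset Strict Implicit.
Unset Printing Implicit Defensive.

(** No linear program is solved: a local-ratio scheme suffices.

    Clear denominators and scale every row to the same right-hand side [P], so
    that the constraints read [E x <= P] with natural entries.  Let [K] be the
    largest number of nonzero entries in a column (at least 1) and [u j] the
    largest feasible multiplicity of column [j] alone.  A column is big if one
    of its entries exceeds [P / 2]; then [u j <= 1].

    The columns are processed once, the small ones first.  When its turn comes,
    a column with a positive residual weight lowers the residual weights of the
    others, in proportion to their load on its rows.  Then columns with a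
    positive residual weight are selected in reverse order:
    - a big column is accepted if each of its rows carries a load of at most
      [P / 2] so far, even if it overflows the row.  In every row only the
      column accepted last can overflow, and a big column is the last one in
      its big row; hence first-fit, in the order opposite to acceptance, splits
      the accepted columns into [K] feasible classes;
    - each small column is then added to each class as often as it fits.

    The local-ratio argument shows that an optimal solution is worth at most
    [max 4 (2 * K)] times the [K] classes together (2 times if the matrix is 0),
    hence at most [2 * k ^ 2 + 2] times the best class.

    All the quantities of this scheme are entries of tables of natural numbers,
    given by expressions with sums, products and maxima over earlier entries.
    Such expressions compile to the random access machine in polynomial time, as
    long as the bit lengths of the entries stay polynomial. *)

Definition memory := nat -> nat -> nat.

Definition blank : memory := fun _ _ => 0.

Definition update (g : memory) (a i v : nat) : memory :=
  fun a' i' => if (a' == a) && (i' == i) then v else g a' i'.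

Inductive binop := OpAdd | OpSub | OpMul | OpDiv | OpMax.

Definition eval_binop (o : binop) (x y : nat) : nat :=
  match o with
  | OpAdd => x + y
  | OpSub => x - y
  | OpMul => x * y
  | OpDiv => x %/ y
  | OpMax => maxn x y
  end.

Inductive aggregate := AggSum | AggProd | AggMax.

Definition agg_binop (k : aggregate) : binop :=
  match k with AggSum => OpAdd | AggProd => OpMul | AggMax => OpMax end.

Definition agg_unit (k : aggregate) : nat := if k is AggProd then 1 else 0.

Definition eval_agg (k : aggregate) (N : nat) (F : nat -> nat) : nat :=
  match k with
  | AggSum => \sum_(i < N) F i
  | AggProd => \prod_(i < N) F i
  | AggMax => \max_(i < N) F i
  end.

Inductive bound := Fixed of nat | Cell of nat & nat.

Definition eval_bound (g : memory) (B : bound) : nat :=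
  match B with Fixed k => k | Cell a i => g a i end.

(* Variables are de Bruijn indices: [Bigop] binds one, and so does the [Table]
   statement that the expression belongs to. *)
Inductive expr :=
  | Lit of nat
  | Var of nat
  | Entry of nat & expr
  | Binop of binop & expr & expr
  | Bigop of aggregate & bound & expr.

Fixpoint eval (g : memory) (env : seq nat) (e : expr) : nat :=
  match e with
  | Lit k => k
  | Var v => nth 0 env v
  | Entry a e1 => g a (eval g env e1)
  | Binop o e1 e2 => eval_binop o (eval g env e1) (eval g env e2)
  | Bigop k B e1 => eval_agg k (eval_bound g B) (fun i => eval g (i :: env) e1)
  end.

Inductive stmt := Input of bound | Table of bound & expr.

Definition stmt_bound (st : stmt) : bound :=
  match st with Input B | Table B _ => B end.

Definition stmt_entry (st : stmt) (w : word) (g : memory) (i : nat) : nat :=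
  match st with Input _ => nth 0 w i | Table _ e => eval g [:: i] e end.

Definition unread (st : stmt) (w : word) (i : nat) : word :=
  if st is Input _ then drop i w else w.

Fixpoint fill (st : stmt) (w : word) (a : nat) (g : memory) (N : nat) :
    memory :=
  if N is i.+1 then
    let g' := fill st w a g i in update g' a i (stmt_entry st w g' i)
  else g.

(* The statements fill the tables number [a], [a + 1], ... one after another. *)
Fixpoint run (a : nat) (g : memory) (w : word) (ss : seq stmt) :
    memory * word :=
  if ss is st :: ss' then
    let N := eval_bound g (stmt_bound st) in
    run a.+1 (fill st w a g N) (unread st w N) ss'
  else (g, w).

Lemma eval_aggS k N F :
  eval_agg k N.+1 F = eval_binop (agg_binop k) (eval_agg k N F) (F N).
Proof. by case: k => /=; rewrite big_ord_recr. Qed.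

Lemma eval_agg0 k F : eval_agg k 0 F = agg_unit k.
Proof. by case: k => /=; rewrite big_ord0. Qed.

Lemma eq_eval_agg k N (F G : nat -> nat) :
  F =1 G -> eval_agg k N F = eval_agg k N G.
Proof. by move=> eq_FG; case: k => /=; apply: eq_bigr => i _; apply: eq_FG. Qed.

Lemma eq_eval_bound g g' B : g =2 g' -> eval_bound g B = eval_bound g' B.
Proof. by move=> eq_g; case: B => /=. Qed.

Lemma eq_eval g g' env e : g =2 g' -> eval g env e = eval g' env e.
Proof.
move=> eq_g; elim: e env => //= [a e IH|o e1 IH1 e2 IH2|k B e IH] env.
- by rewrite IH eq_g.
- by rewrite IH1 IH2.
- by rewrite (eq_eval_bound B eq_g); apply: eq_eval_agg.
Qed.

Lemma eq_stmt_entry st w g g' : g =2 g' ->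
  stmt_entry st w g =1 stmt_entry st w g'.
Proof. by case: st => // B e eq_g i; apply: eq_eval. Qed.

(* What entry [i] of table [a] can see: all the earlier tables, and the earlier
   entries of its own table; everything else still holds 0. *)
Definition visible (M : memory) (a i : nat) : memory :=
  fun b j => if b < a then M b j else if b == a then (j < i) * M b j else 0.

Definition memory_le (g M : memory) : Prop := forall a i, g a i <= M a i.

Lemma visible_le M a i : memory_le (visible M a i) M.
Proof.
move=> b j; rewrite /visible; case: ltngtP => // _.
by case: (j < i); rewrite ?mul1n.
Qed.

Lemma fill_entry st w a g N b i :
  fill st w a g N b i =
  if (b == a) && (i < N) then stmt_entry st w (fill st w a g i) i else g b i.
Proof.
elim: N => [|N IH] /=; first by rewrite andbF.
rewrite /update IH ltnS (leq_eqVlt i N); case: (b == a) => //=.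
by case: (i =P N) => [->|].
Qed.

Lemma fill_other st w a g N b : b != a -> fill st w a g N b =1 g b.
Proof. by move=> neq_b i; rewrite fill_entry (negPf neq_b). Qed.

Lemma run_cat a g w ss1 ss2 :
  run a g w (ss1 ++ ss2) =
  run (a + size ss1) (run a g w ss1).1 (run a g w ss1).2 ss2.
Proof.
by elim: ss1 a g w => [|st ss1 IH] a g w /=; rewrite ?addn0 // IH addSnnS.
Qed.

Lemma run_before a g w ss b : b < a -> (run a g w ss).1 b =1 g b.
Proof.
elim: ss a g w => //= st ss IH a g w lt_b i.
by rewrite IH ?ltnS ?(ltnW lt_b) // fill_entry ltn_eqF.
Qed.

Lemma run_after a g w ss b : a + size ss <= b -> (run a g w ss).1 b =1 g b.
Proof.
elim: ss a g w => //= st ss IH a g w le_b i.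
rewrite IH ?addSnnS // fill_entry gtn_eqF //.
by apply: leq_trans le_b; rewrite -addSnnS leq_addr.
Qed.

Lemma run_ge a g w ss : (forall b, a <= b -> g b =1 fun=> 0) ->
  memory_le g (run a g w ss).1.
Proof.
move=> g_after b i; have [lt_b|le_b] := ltnP b a; first by rewrite run_before.
by rewrite g_after.
Qed.

(* Given as an equation [M = (run 0 blank w ss).1] in the context, the run would
   be evaluated by the tactic [done]. *)
Variant run_of (w : word) (ss : seq stmt) : memory -> Prop :=
  RunOf : run_of w ss (run 0 blank w ss).1.

Lemma run_ofE w ss M : run_of w ss M -> M = (run 0 blank w ss).1.
Proof. by case. Qed.

Section RunEntries.
Variables (w : word) (ss : seq stmt) (M : memory).
Hypothesis M_run : run_of w ss M.

Definition input_at (a : nat) : word := (run 0 blank w (take a ss)).2.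

Lemma run_entry a i : a < size ss ->
  let st := nth (Input (Fixed 0)) ss a in
  M a i = if i < eval_bound (visible M a 0) (stmt_bound st)
          then stmt_entry st (input_at a) (visible M a i) i else 0.
Proof.
move=> lt_a st; set g := (run 0 blank w (take a ss)).1.
have size_a : size (take a ss) = a by rewrite size_takel // ltnW.
set N := eval_bound g (stmt_bound st); pose gN := fill st (input_at a) a g N.
have M_before b : b < a.+1 -> M b =1 gN b.
  move=> lt_b j; rewrite (run_ofE M_run) -{1}(cat_take_drop a ss) run_cat.
  by rewrite size_a (drop_nth (Input (Fixed 0)) lt_a) /= run_before.
have g_after b : a <= b -> g b =1 fun=> 0.
  by move=> le_b j; rewrite /g run_after ?size_a.
have fill_visible j : j <= N -> fill st (input_at a) a g j =2 visible M a j.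
  move=> le_j b k; rewrite /visible; case: ltngtP => [lt_b|lt_b|->].
  - by rewrite M_before ?ltnS 1?ltnW // /gN !fill_entry ltn_eqF.
  - by rewrite fill_entry gtn_eqF //= g_after // ltnW.
  - rewrite M_before // /gN !fill_entry eqxx /=; case: ltnP => [lt_k|_].
      by rewrite (leq_trans lt_k le_j) mul1n.
    by rewrite g_after.
rewrite -(eq_eval_bound _ (fill_visible 0 isT)) -/N M_before // /gN fill_entry.
rewrite eqxx /=; case: ltnP => [lt_i|_]; last by rewrite g_after.
exact: eq_stmt_entry (fill_visible i (ltnW lt_i)) i.
Qed.

Lemma table_entry a B e i : nth (Input (Fixed 0)) ss a = Table B e ->
  a < size ss -> i < eval_bound (visible M a 0) B ->
  M a i = eval (visible M a i) [:: i] e.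
Proof. by move=> eq_st lt_a lt_i; rewrite run_entry // eq_st /= lt_i. Qed.

Lemma table_default a B e i : nth (Input (Fixed 0)) ss a = Table B e ->
  a < size ss -> eval_bound (visible M a 0) B <= i -> M a i = 0.
Proof.
by move=> eq_st lt_a le_i; rewrite run_entry // eq_st /= ltnNge le_i.
Qed.

Lemma input_entry a B i : nth (Input (Fixed 0)) ss a = Input B ->
  a < size ss ->
  M a i = if i < eval_bound (visible M a 0) B then nth 0 (input_at a) i else 0.
Proof. by move=> eq_st lt_a; rewrite run_entry // eq_st. Qed.

End RunEntries.

(** * Bit lengths *)

Lemma bitlen_leE v b : 0 < b -> (bitlen v <= b) = (v < 2 ^ b).
Proof.
move=> b_gt0; rewrite /bitlen; have [->|v_gt0] := posnP v.
  by rewrite trunc_log0 b_gt0 expn_gt0.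
apply/idP/idP => [lt_b|].
  by apply: leq_trans (trunc_log_ltn v (isT : 1 < 2)) _; rewrite leq_pexp2l.
apply: contraTT; rewrite -!leqNgt => le_b.
exact: leq_trans (leq_pexp2l (isT : 0 < 2) le_b) (trunc_logP _ v_gt0).
Qed.

Lemma leq_bitlen x y : x <= y -> bitlen x <= bitlen y.
Proof. by move=> le_xy; rewrite /bitlen ltnS leq_trunc_log. Qed.

Lemma ltn_bitlen x : x < 2 ^ bitlen x.
Proof. by rewrite -bitlen_leE. Qed.

Lemma bitlen_ltn x y : x < y -> bitlen x <= y.
Proof.
case: y => // y lt_xy; rewrite bitlen_leE //.
exact: leq_trans lt_xy (ltnW (ltn_expl _ _)).
Qed.

Lemma bitlenM x y : bitlen (x * y) <= bitlen x + bitlen y.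
Proof.
rewrite bitlen_leE ?addn_gt0 // expnD.
have := ltn_bitlen x; have := ltn_bitlen y; nia.
Qed.

Lemma bitlenD x y : bitlen (x + y) <= bitlen x + bitlen y.
Proof.
rewrite bitlen_leE ?addn_gt0 // expnD.
have two_le z : 2 <= 2 ^ bitlen z by rewrite (leq_pexp2l (m := 2) (n1 := 1)).
have := two_le x; have := two_le y.
have := ltn_bitlen x; have := ltn_bitlen y; nia.
Qed.

Lemma bitlen_binop o x y : bitlen (eval_binop o x y) <= bitlen x + bitlen y.
Proof.
case: o => /=; rewrite ?bitlenD ?bitlenM //.
- by apply: leq_trans (leq_bitlen (leq_subr _ _)) (leq_addr _ _).
- by apply: leq_trans (leq_bitlen (leq_div _ _)) (leq_addr _ _).
- apply: leq_trans (bitlenD x y); apply: leq_bitlen; lia.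
Qed.

Lemma bitlen_agg k N F b : (forall i, i < N -> bitlen (F i) <= b) ->
  bitlen (eval_agg k N F) <= 1 + N * b.
Proof.
elim: N => [|N IH] le_F; first by rewrite eval_agg0; case: k.
rewrite eval_aggS; apply: leq_trans (bitlen_binop _ _ _) _.
rewrite mulSn addnCA addnC leq_add ?le_F //.
by apply: IH => i lt_iN; apply: le_F; apply: ltnW.
Qed.

Definition word_bits_le (b : nat) (w : word) : bool :=
  all (fun v => bitlen v <= b) w.

Lemma word_bits_le_nth b w i : 0 < b -> word_bits_le b w ->
  bitlen (nth 0 w i) <= b.
Proof.
move=> b_gt0 /allP le_w; have [lt_i|le_i] := ltnP i (size w).
  exact/le_w/mem_nth.
by rewrite nth_default.
Qed.

Lemma word_bits_le_word_size w : word_bits_le (word_size w) w.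
Proof.
apply/allP => v; elim: w => // x w IH; rewrite inE /word_size big_cons.
by case/predU1P=> [->|/IH le_v];
  [apply: leq_addr | apply: leq_trans le_v (leq_addl _ _)].
Qed.

Lemma size_le_word_size w : size w <= word_size w.
Proof. by rewrite /word_size -sum1_size; apply: leq_sum. Qed.

Definition memory_bits_le (b : nat) (g : memory) : Prop :=
  forall a i, bitlen (g a i) <= b.

Lemma memory_bits_le_trans b g M :
  memory_le g M -> memory_bits_le b M -> memory_bits_le b g.
Proof.
move=> le_g M_bits a i.
exact: leq_trans (leq_bitlen (le_g a i)) (M_bits a i).
Qed.

Fixpoint loop_bounds (e : expr) : seq bound :=
  match e with
  | Lit _ | Var _ => [::]
  | Entry _ e1 => loop_bounds e1
  | Binop _ e1 e2 => loop_bounds e1 ++ loop_bounds e2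
  | Bigop _ B e1 => B :: loop_bounds e1
  end.

Definition bounded_by (b : nat) (g : memory) (Bs : seq bound) : bool :=
  all (fun B => eval_bound g B <= b) Bs.

Lemma bounded_by_cat b g Bs1 Bs2 :
  bounded_by b g (Bs1 ++ Bs2) = bounded_by b g Bs1 && bounded_by b g Bs2.
Proof. exact: all_cat. Qed.

Lemma eval_bound_le g M B : memory_le g M -> eval_bound g B <= eval_bound M B.
Proof. by move=> le_g; case: B => /=. Qed.

Lemma bounded_by_le g M b Bs :
  memory_le g M -> bounded_by b M Bs -> bounded_by b g Bs.
Proof.
by move=> le_g; apply: sub_all => B; apply: leq_trans (eval_bound_le B le_g).
Qed.

(* The tables whose contents bound the value of an expression; the subtrahend
   of a truncated subtraction, a divisor and an index do not matter. *)
Fixpoint size_reads (e : expr) : seq nat :=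
  match e with
  | Lit _ | Var _ => [::]
  | Entry a _ => [:: a]
  | Binop OpSub e1 _ | Binop OpDiv e1 _ => size_reads e1
  | Binop _ e1 e2 => size_reads e1 ++ size_reads e2
  | Bigop _ _ e1 => size_reads e1
  end.

Fixpoint value_bits (b : nat) (e : expr) : nat :=
  match e with
  | Lit k => bitlen k
  | Var _ | Entry _ _ => b
  | Binop OpSub e1 _ | Binop OpDiv e1 _ => value_bits b e1
  | Binop _ e1 e2 => value_bits b e1 + value_bits b e2
  | Bigop _ _ e1 => 1 + b * value_bits b e1
  end.

Lemma bitlen_eval b g env e : 0 < b ->
  (forall a i, a \in size_reads e -> bitlen (g a i) <= b) ->
  bounded_by b g (loop_bounds e) -> word_bits_le b env ->
  bitlen (eval g env e) <= value_bits b e.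
Proof.
move=> b_gt0; elim: e env => [k|v|a e1 _|o e1 IH1 e2 IH2|k B e1 IH1] env /=.
- by [].
- by move=> _ _; apply: word_bits_le_nth.
- by move=> le_g _ _; apply: le_g; rewrite inE.
- move=> le_g; rewrite bounded_by_cat => /andP[Bs1 Bs2] le_env.
  have le1 : bitlen (eval g env e1) <= value_bits b e1.
    by apply: IH1 => // a i a_e1; apply: le_g; case: o => //=;
      rewrite mem_cat a_e1.
  have reads2 a : o <> OpSub -> o <> OpDiv -> a \in size_reads e2 ->
      a \in size_reads (Binop o e1 e2).
    by case: o {le_g} => //= _ _ a_e2; rewrite mem_cat a_e2 orbT.
  have le2 : o <> OpSub -> o <> OpDiv ->
      bitlen (eval g env e2) <= value_bits b e2.
    by move=> not_sub not_div;
      apply: IH2 => // a i /(reads2 a not_sub not_div)/le_g.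
  case: o {le_g reads2} le2 => le2 /=;
    first [by apply: leq_trans (bitlen_binop OpAdd _ _) (leq_add le1 (le2 _ _))
          |by apply: leq_trans (bitlen_binop OpMul _ _) (leq_add le1 (le2 _ _))
          |by apply: leq_trans (bitlen_binop OpMax _ _) (leq_add le1 (le2 _ _))
          |by apply: leq_trans (leq_bitlen _) le1; rewrite ?leq_subr ?leq_div].
- move=> le_g /andP[le_B Bs] le_env.
  apply: leq_trans (bitlen_agg _ (b := value_bits b e1) _) _.
    move=> i lt_i; apply: IH1 => //=; apply/andP; split=> //.
    exact: leq_trans (bitlen_ltn lt_i) le_B.
  by rewrite leq_add2l leq_mul2r le_B orbT.
Qed.

Definition poly_bounded (f : nat -> nat) : Prop :=
  exists d, forall b, 1 < b -> f b <= b ^ d.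

Lemma poly_bounded_const k : poly_bounded (fun=> k).
Proof.
exists k => b b_gt1; apply: leq_trans (ltnW (ltn_expl k (isT : 1 < 2))) _.
by case: k => // k; rewrite leq_exp2r.
Qed.

Lemma poly_bounded_id : poly_bounded id.
Proof. by exists 1 => b _; rewrite expn1. Qed.

Lemma poly_boundedD f1 f2 :
  poly_bounded f1 -> poly_bounded f2 -> poly_bounded (fun b => f1 b + f2 b).
Proof.
case=> d1 le1 [d2 le2]; exists (d1 + d2).+1 => b b_gt1; rewrite expnS expnD.
apply: leq_trans (leq_add (le1 b b_gt1) (le2 b b_gt1)) _.
have : 0 < b ^ d1 by rewrite expn_gt0 ltnW.
have : 0 < b ^ d2 by rewrite expn_gt0 ltnW.
move: (b ^ d1) (b ^ d2) => x y y_gt0 x_gt0.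
by apply: leq_trans (leq_mul b_gt1 (leqnn (x * y))); nia.
Qed.

Lemma poly_boundedM f1 f2 :
  poly_bounded f1 -> poly_bounded f2 -> poly_bounded (fun b => f1 b * f2 b).
Proof.
case=> d1 le1 [d2 le2]; exists (d1 + d2) => b b_gt1.
by rewrite expnD leq_mul ?le1 ?le2.
Qed.

Lemma poly_bounded_exp f d : poly_bounded f ->
  exists d', forall L, f (L.+2 ^ d.+1) <= L.+2 ^ d'.
Proof.
case=> e le_f; exists (d.+1 * e) => L; rewrite expnM; apply: le_f.
by rewrite -{1}(expn0 L.+2) ltn_exp2l.
Qed.

Ltac poly_bounded_tac :=
  lazymatch goal with
  | |- poly_bounded (fun b => _ + _) => apply: poly_boundedD; poly_bounded_tac
  | |- poly_bounded (fun b => _ * _) => apply: poly_boundedM; poly_bounded_tac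
  | |- poly_bounded (fun b => b) => exact: poly_bounded_id
  | |- _ => first [solve [auto] | exact: poly_bounded_const]
  end.

Lemma poly_bounded_value_bits e : poly_bounded (value_bits^~ e).
Proof.
elim: e => [k|v|a e1 _|o e1 IH1 e2 IH2|k B e1 IH1] /=; try poly_bounded_tac.
by case: o => //; poly_bounded_tac.
Qed.

(** * Compilation to the random access machine *)

Definition is_halt (i : instr) : bool := if i is Halt then true else false.

Definition is_jump (i : instr) : bool :=
  match i with Jump _ | Jzero _ _ => true | _ => false end.

Definition immediates (i : instr) : seq nat :=
  match i with
  | Const i v => [:: i; v]
  | Add i j k | Defs.Sub i j k | Mul i j k | Div i j k => [:: i; j; k]
  | Fetch i j | Store i j => [:: i; j]
  | Jump l => [:: l]
  | Jzero i l => [:: i; l]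
  | Read i | Write i => [:: i]
  | Halt => [::]
  end.

Definition operands (s : state) (i : instr) : seq nat :=
  let R := regs s in
  match i with
  | Add _ j k | Defs.Sub _ j k | Mul _ j k | Div _ j k => [:: R j; R k]
  | Fetch _ j => [:: R j; R (R j)]
  | Store i j => [:: R i; R j]
  | Jzero i _ => [:: R i]
  | Read _ => [:: head 0 (inp s)]
  | Write i => [:: R i]
  | Const _ _ | Jump _ | Halt => [::]
  end.

Definition effect (s : state) (i : instr) : state :=
  let R := regs s in
  match i with
  | Const i v => set_reg s i v
  | Add i j k => set_reg s i (R j + R k)
  | Defs.Sub i j k => set_reg s i (R j - R k)
  | Mul i j k => set_reg s i (R j * R k)
  | Div i j k => set_reg s i (R j %/ R k)
  | Fetch i j => set_reg s i (R (R j))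
  | Store i j => set_reg s (R i) (R j)
  | Jump l => goto s l
  | Jzero i l => goto s (if R i == 0 then l else (pc s).+1)
  | Read i => State (pc s).+1 [eta R with i |-> head 0 (inp s)]
                    (behead (inp s)) (out s)
  | Write i => State (pc s).+1 R (inp s) (rcons (out s) (R i))
  | Halt => s
  end.

Fixpoint all_operands (s : state) (c : seq instr) : seq nat :=
  if c is i :: c' then operands s i ++ all_operands (effect s i) c' else [::].

Lemma step_effect p s i : nth Halt p (pc s) = i -> ~~ is_halt i ->
  step p s = Some (word_size (immediates i ++ operands s i), effect s i).
Proof.
by move=> <-; rewrite /step /word_size; case: (nth _ _ _) => //= *;
  congr (Some (_, _)); rewrite ?big_cons big_nil; lia.
Qed.

Lemma pc_effect s i : ~~ is_halt i -> ~~ is_jump i ->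
  pc (effect s i) = (pc s).+1.
Proof. by case: i. Qed.

Definition code_at (p : program) (off : nat) (c : seq instr) : Prop :=
  forall k, k < size c -> nth Halt p (off + k) = nth Halt c k.

Lemma code_at_cat p off c1 c2 : code_at p off (c1 ++ c2) ->
  code_at p off c1 /\ code_at p (off + size c1) c2.
Proof.
move=> pc; split=> k lt_k.
  by rewrite pc ?nth_cat ?lt_k // size_cat ltn_addr.
by rewrite -addnA pc ?size_cat ?ltn_add2l // nth_cat ltnNge leq_addr addKn.
Qed.

Lemma code_at_cons p off i c : code_at p off (i :: c) ->
  nth Halt p off = i /\ code_at p off.+1 c.
Proof.
move=> pc; split=> [|k lt_k]; first by have := pc 0 isT; rewrite addn0.
by rewrite addSnnS pc.
Qed.

Inductive star (p : program) : state -> nat -> state -> Prop :=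
  | star_refl s : star p s 0 s
  | star_step s c s1 t s2 :
      step p s = Some (c, s1) -> star p s1 t s2 -> star p s (c + t) s2.

Lemma star_trans p s t s1 t1 s2 :
  star p s t s1 -> star p s1 t1 s2 -> star p s (t + t1) s2.
Proof.
elim=> [s' //|s' c s1' t' s2' eq_step _ IH /IH star1].
by rewrite -addnA; apply: star_step eq_step star1.
Qed.

Lemma star_runs p s t s1 : star p s t s1 -> step p s1 = None -> runs p s t s1.
Proof.
elim=> [s'|s' c s1' t' s2' eq_step _ IH /IH runs1]; first exact: runs_halt.
exact: runs_step eq_step runs1.
Qed.

Definition static_bits (p : program) : nat :=
  word_size (flatten (map immediates p)).

Lemma static_bitsP p k :
  word_bits_le (static_bits p) (immediates (nth Halt p k)).
Proof.
have [lt_k|le_k] := ltnP k (size p); last by rewrite nth_default.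
apply/allP => v v_k; apply: (allP (word_bits_le_word_size _)).
apply/flattenP; exists (immediates (nth Halt p k)) => //.
by rewrite -(nth_map Halt [::] immediates) // mem_nth ?size_map.
Qed.

(* Registers are split by residue modulo [stride]: residue 0 holds temporaries
   and residue [a + 1] holds table [a]. *)
Definition stride : nat := 32.
Definition temp (d : nat) : nat := d * stride.
Definition slot (a i : nat) : nat := i * stride + a.+1.

Lemma eq_temp d d' : (temp d == temp d') = (d == d').
Proof. by rewrite /temp eqn_pmul2r. Qed.

Lemma slot_neq_temp a i d : a.+1 < stride -> (slot a i == temp d) = false.
Proof. rewrite /slot /temp /stride => lt_a; apply/eqP; lia. Qed.

Lemma eq_slot a i a' i' : a.+1 < stride -> a'.+1 < stride ->
  (slot a i == slot a' i') = (a == a') && (i == i').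
Proof. rewrite /slot /stride => lt_a lt_a'; apply/eqP/andP; lia. Qed.

Definition same_but (d1 d2 : nat) (R R' : nat -> nat) : Prop :=
  forall r, r != temp d1 -> r != temp d2 -> R' r = R r.

Definition same_below (d : nat) (R R' : nat -> nat) : Prop :=
  forall r, (forall d', d <= d' -> r != temp d') -> R' r = R r.

Lemma same_below_temp d R R' d' : same_below d R R' -> d' < d ->
  R' (temp d') = R (temp d').
Proof.
by move=> same lt_d; apply: same => d1 le_d1; rewrite eq_temp; apply/eqP; lia.
Qed.

Lemma same_below_slot d R R' a i : same_below d R R' -> a.+1 < stride ->
  R' (slot a i) = R (slot a i).
Proof. by move=> same lt_a; apply: same => d1 _; rewrite slot_neq_temp. Qed.

Lemma same_below_trans d R1 R2 R3 : same_below d R1 R2 ->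
  same_below d R2 R3 -> same_below d R1 R3.
Proof. by move=> s12 s23 r r_d; rewrite s23 // s12. Qed.

Lemma same_below_leq d d' R1 R2 : d' <= d -> same_below d R1 R2 ->
  same_below d' R1 R2.
Proof.
by move=> le_d s12 r r_d; apply: s12 => d1 le1; apply: r_d;
  apply: leq_trans le1.
Qed.

Lemma same_below_set d d' s v : d <= d' ->
  same_below d (regs s) (regs (set_reg s (temp d') v)).
Proof. by move=> le_d r r_d /=; rewrite (negPf (r_d _ le_d)). Qed.

Lemma same_but_below d d1 d2 R R' : d <= d1 -> d <= d2 ->
  same_but d1 d2 R R' -> same_below d R R'.
Proof. by move=> le1 le2 same r r_d; apply: same; apply: r_d. Qed.

Definition represents (R : nat -> nat) (g : memory) : Prop :=
  forall a i, a.+1 < stride -> R (slot a i) = g a i.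

Lemma represents_same d R R' g : same_below d R R' -> represents R g ->
  represents R' g.
Proof. by move=> same rep a i lt_a; rewrite (same_below_slot _ same) ?rep. Qed.

Definition binop_code (o : binop) (x y : nat) : seq instr :=
  match o with
  | OpAdd => [:: Add (temp x) (temp x) (temp y)]
  | OpSub => [:: Defs.Sub (temp x) (temp x) (temp y)]
  | OpMul => [:: Mul (temp x) (temp x) (temp y)]
  | OpDiv => [:: Div (temp x) (temp x) (temp y)]
  | OpMax => [:: Defs.Sub (temp y) (temp y) (temp x);
                 Add (temp x) (temp x) (temp y)]
  end.

Definition slot_code (d a : nat) : seq instr :=
  [:: Const (temp d.+1) stride; Mul (temp d) (temp d) (temp d.+1);
      Const (temp d.+1) a.+1; Add (temp d) (temp d) (temp d.+1)].

Definition slot_bits (b a : nat) : nat := b + bitlen stride + bitlen a.+1.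

Lemma bitlen_slot b a i : bitlen i <= b -> bitlen (slot a i) <= slot_bits b a.
Proof.
move=> le_i; apply: leq_trans (bitlenD _ _) _; rewrite leq_add2r.
by apply: leq_trans (bitlenM _ _) _; rewrite leq_add2r.
Qed.

Definition bound_code (d : nat) (B : bound) : seq instr :=
  match B with
  | Fixed k => [:: Const (temp d) k]
  | Cell a i => [:: Const (temp d) (slot a i); Fetch (temp d) (temp d)]
  end.

Definition bound_wf (B : bound) : bool :=
  if B is Cell a _ then a.+1 < stride else true.

Definition loop_head (off d : nat) (B : bound) : nat :=
  off + (size (bound_code d.+1 B)).+1.

Definition loop_body (off d : nat) (B : bound) : nat := (loop_head off d B).+2.

Definition loop_exit (off d : nat) (B : bound) (c : seq instr) : nat :=
  loop_body off d B + (size c + 3).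

(* The bound of the loop is kept in [temp d.+1] and its counter in
   [temp d.+2]. *)
Definition loop_code (off d : nat) (B : bound) (c : seq instr) : seq instr :=
  (bound_code d.+1 B ++
   [:: Const (temp d.+2) 0; Defs.Sub (temp d.+3) (temp d.+1) (temp d.+2);
       Jzero (temp d.+3) (loop_exit off d B c)]) ++
  c ++
  [:: Const (temp d.+3) 1; Add (temp d.+2) (temp d.+2) (temp d.+3);
      Jump (loop_head off d B)].

Definition loop_steps (N T : nat) : nat := N * (T + 5) + 5.

Fixpoint expr_wf (n : nat) (e : expr) : bool :=
  match e with
  | Lit _ => true
  | Var v => v < n
  | Entry a e1 => (a.+1 < stride) && expr_wf n e1
  | Binop _ e1 e2 => expr_wf n e1 && expr_wf n e2
  | Bigop _ B e1 => bound_wf B && expr_wf n.+1 e1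
  end.

(* The value of the expression is left in [temp d]; variable [v] is in
   [temp (nth 0 venv v)]. *)
Fixpoint expr_code (off : nat) (venv : seq nat) (d : nat) (e : expr) :
    seq instr :=
  match e with
  | Lit k => [:: Const (temp d) k]
  | Var v => [:: Const (temp d) 0; Add (temp d) (temp d) (temp (nth 0 venv v))]
  | Entry a e1 =>
      expr_code off venv d e1 ++ slot_code d a ++ [:: Fetch (temp d) (temp d)]
  | Binop o e1 e2 =>
      let c1 := expr_code off venv d e1 in
      c1 ++ expr_code (off + size c1) venv d.+1 e2 ++ binop_code o d d.+1
  | Bigop k B e1 =>
      Const (temp d) (agg_unit k) ::
      loop_code off.+1 d B
        (expr_code (loop_body off.+1 d B) (d.+2 :: venv) d.+3 e1 ++
         binop_code (agg_binop k) d d.+3)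
  end.

Fixpoint expr_steps (b : nat) (e : expr) : nat :=
  match e with
  | Lit _ => 1
  | Var _ => 2
  | Entry _ e1 => expr_steps b e1 + 5
  | Binop _ e1 e2 => expr_steps b e1 + (expr_steps b e2 + 2)
  | Bigop _ _ e1 => 1 + loop_steps b (expr_steps b e1 + 2)
  end.

(* Bounds the bit lengths of all the numbers that the code handles, when those
   in the tables and the variables and those of the loops are at most [b]. *)
Fixpoint work_bits (b : nat) (e : expr) : nat :=
  value_bits b e +
  match e with
  | Lit _ | Var _ => 0
  | Entry a e1 => work_bits b e1 + slot_bits (value_bits b e1) a
  | Binop _ e1 e2 => work_bits b e1 + work_bits b e2
  | Bigop _ _ e1 => work_bits b e1 + b + 1
  end.

Lemma poly_bounded_expr_steps e : poly_bounded (expr_steps^~ e).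
Proof. by elim: e => *; rewrite /= /loop_steps; poly_bounded_tac. Qed.

Lemma poly_bounded_work_bits e : poly_bounded (work_bits^~ e).
Proof.
elim: e => [k|v|a e1 IH1|o e1 IH1 e2 IH2|k B e1 IH1];
  apply: poly_boundedD (poly_bounded_value_bits _) _; try poly_bounded_tac.
have := poly_bounded_value_bits e1; rewrite /slot_bits => le1; poly_bounded_tac.
Qed.

Lemma value_bits_le_work b e : value_bits b e <= work_bits b e.
Proof. by case: e => *; rewrite /= leq_addr. Qed.

Lemma leq_loop_steps N M T : N <= M -> loop_steps N T <= loop_steps M T.
Proof. by move=> le_NM; rewrite leq_add2r leq_mul2r le_NM orbT. Qed.

Definition stmt_wf (st : stmt) : bool :=
  match st with
  | Input B => bound_wf B
  | Table B e => bound_wf B && expr_wf 1 e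
  end.

Definition stmt_bounds (st : stmt) : seq bound :=
  match st with Input B => [:: B] | Table B e => B :: loop_bounds e end.

Definition prog_bounds (ss : seq stmt) : seq bound :=
  flatten (map stmt_bounds ss).

(* The loop of a statement counts in [temp 2] and computes entries in
   [temp 3]. *)
Definition entry_code (off : nat) (st : stmt) : seq instr :=
  match st with
  | Input _ => [:: Read (temp 3)]
  | Table _ e => expr_code off [:: 2] 3 e
  end.

(* The code of a variable does not depend on its position. *)
Definition store_code (a : nat) : seq instr :=
  expr_code 0 [:: 2] 4 (Var 0) ++ slot_code 4 a ++ [:: Store (temp 4) (temp 3)].

Definition stmt_code (off a : nat) (st : stmt) : seq instr :=
  let off1 := loop_body off 0 (stmt_bound st) in
  loop_code off 0 (stmt_bound st) (entry_code off1 st ++ store_code a).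

Fixpoint prog_code (off a : nat) (ss : seq stmt) : seq instr :=
  if ss is st :: ss' then
    let c := stmt_code off a st in c ++ prog_code (off + size c) a.+1 ss'
  else [::].

Definition output_code (off a : nat) (B : bound) : seq instr :=
  let off1 := loop_body off 0 B in
  loop_code off 0 B (expr_code off1 [:: 2] 3 (Entry a (Var 0)) ++
                     [:: Write (temp 3)]).

Definition compile (ss : seq stmt) (B : bound) : program :=
  let c := prog_code 0 0 ss in c ++ output_code (size c) (size ss).-1 B.

Definition entry_steps (b : nat) (st : stmt) : nat :=
  if st is Table _ e then expr_steps b e else 1.

Definition stmt_steps (b : nat) (st : stmt) : nat :=
  loop_steps b (entry_steps b st + 7).

Definition stmt_work (b a : nat) (st : stmt) : nat :=
  (if st is Table _ e then work_bits b e else b) + slot_bits b a + b + 1.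

Fixpoint prog_steps (b : nat) (ss : seq stmt) : nat :=
  if ss is st :: ss' then stmt_steps b st + prog_steps b ss' else 0.

Fixpoint prog_work (b a : nat) (ss : seq stmt) : nat :=
  if ss is st :: ss' then stmt_work b a st + prog_work b a.+1 ss' else 0.

Definition output_steps (b a : nat) : nat :=
  loop_steps b (expr_steps b (Entry a (Var 0)) + 1).

Definition output_work (b a : nat) : nat :=
  work_bits b (Entry a (Var 0)) + b + 1.

Definition compile_time (ss : seq stmt) (B : bound) (b : nat) : nat :=
  let a := (size ss).-1 in
  (prog_steps b ss + output_steps b a) *
  (5 * (static_bits (compile ss B) + prog_work b 0 ss + output_work b a)).

Lemma poly_bounded_compile_time ss B : poly_bounded (compile_time ss B).
Proof.
have poly_steps st : poly_bounded (stmt_steps^~ st).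
  have poly_entry : poly_bounded (entry_steps^~ st).
    case: st => [B'|B' e] /=; first exact: poly_bounded_const.
    exact: poly_bounded_expr_steps.
  by rewrite /stmt_steps /loop_steps; poly_bounded_tac.
have poly_work a st : poly_bounded (fun b => stmt_work b a st).
  rewrite /stmt_work /slot_bits.
  case: st => [B'|B' e]; first by poly_bounded_tac.
  by have := poly_bounded_work_bits e => poly_e; poly_bounded_tac.
have poly_prog_steps : poly_bounded (prog_steps^~ ss).
  elim: (ss) => [|st ss' IH] /=; first exact: poly_bounded_const.
  exact: poly_boundedD (poly_steps st) IH.
have poly_prog_work a : poly_bounded (fun b => prog_work b a ss).
  elim: (ss) a => [|st ss' IH] a /=; first exact: poly_bounded_const.
  exact: poly_boundedD (poly_work a st) (IH a.+1).
have poly_output a : poly_bounded (output_steps^~ a).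
  have := poly_bounded_expr_steps (Entry a (Var 0)) => poly_e.
  by rewrite /output_steps /loop_steps; poly_bounded_tac.
have poly_output_work a : poly_bounded (output_work^~ a).
  have := poly_bounded_work_bits (Entry a (Var 0)) => poly_e.
  by rewrite /output_work; poly_bounded_tac.
by rewrite /compile_time; poly_bounded_tac.
Qed.

Section Execution.
Variables (p : program) (q : nat).
Hypothesis static_le : static_bits p <= q.

(* An instruction handles at most 5 numbers, all of them of at most [q] bits. *)
Definition reach (T : nat) (s s' : state) : Prop :=
  exists2 t, t <= T * (5 * q) & star p s t s'.

Lemma reach_trans T1 T2 s s1 s2 :
  reach T1 s s1 -> reach T2 s1 s2 -> reach (T1 + T2) s s2.
Proof.
case=> t1 le1 r1 [t2 le2 r2]; exists (t1 + t2); last exact: star_trans r1 r2.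
by rewrite mulnDl leq_add.
Qed.

Lemma reach_refl T s : reach T s s.
Proof. by exists 0 => //; apply: star_refl. Qed.

Lemma reach_leq T T' s s' : T <= T' -> reach T s s' -> reach T' s s'.
Proof.
move=> le_T [t le_t r]; exists t => //; apply: leq_trans le_t _.
by rewrite leq_mul2r le_T orbT.
Qed.

Lemma immediate_le k v : v \in immediates (nth Halt p k) -> bitlen v <= q.
Proof. by move/(allP (static_bitsP p k))/leq_trans; apply. Qed.

Lemma reach_instr s i : nth Halt p (pc s) = i -> ~~ is_halt i ->
  word_bits_le q (operands s i) -> reach 1 s (effect s i).
Proof.
move=> eq_i no_halt le_ops; pose w := immediates i ++ operands s i.
exists (word_size w + 0); last first.
  exact: star_step (step_effect eq_i no_halt) (star_refl _ _).
have le_w : word_bits_le q w.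
  rewrite /word_bits_le all_cat -!/(word_bits_le _ _) le_ops andbT -eq_i.
  by apply/allP => v /immediate_le.
have size_w : size w <= 5 by rewrite /w; case: (i).
rewrite addn0 mul1n; apply: leq_trans (_ : size w * q <= _).
  rewrite /word_size -sum1_size big_distrl /= !big_seq; apply: leq_sum => v v_w.
  by rewrite mul1n (allP le_w).
by rewrite leq_mul2r size_w orbT.
Qed.

Definition straight (i : instr) : bool := ~~ is_halt i && ~~ is_jump i.

Lemma reach_straight s c : code_at p (pc s) c -> all straight c ->
  word_bits_le q (all_operands s c) -> reach (size c) s (foldl effect s c).
Proof.
elim: c s => [|i c IH] s /=; first by move=> _ _ _; apply: reach_refl.
case/code_at_cons=> eq_i code /andP[/andP[no_halt no_jump] straight_c].
rewrite /word_bits_le all_cat => /andP[le_i le_c]; rewrite -add1n.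
apply: reach_trans (reach_instr eq_i no_halt le_i) (IH _ _ straight_c le_c).
by rewrite pc_effect.
Qed.

Definition computes (T : nat) (c : seq instr) (d v : nat)
    (same : (nat -> nat) -> (nat -> nat) -> Prop) (s : state) : Prop :=
  exists2 s', reach T s s' &
    [/\ pc s' = pc s + size c, inp s' = inp s, out s' = out s,
        regs s' (temp d) = v & same (regs s) (regs s')].

Lemma computes_trans T1 T2 c1 c2 d1 d2 v1 v2 same1 same s :
  computes T1 c1 d1 v1 same1 s ->
  (forall s', pc s' = pc s + size c1 -> regs s' (temp d1) = v1 ->
     same1 (regs s) (regs s') ->
     computes T2 c2 d2 v2 (fun _ => same (regs s)) s') ->
  computes (T1 + T2) (c1 ++ c2) d2 v2 same s.
Proof.
case=> s1 r1 [pc1 in1 out1 v1s same_s1] /(_ s1 pc1 v1s same_s1).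
case=> s2 r2 [pc2 in2 out2 v2s same_s2].
exists s2; first exact: reach_trans r1 r2.
by split; rewrite ?in2 ?out2 // pc2 pc1 size_cat addnA.
Qed.

Lemma binop_code_correct o x y s : x != y ->
  code_at p (pc s) (binop_code o x y) ->
  bitlen (regs s (temp x)) <= q -> bitlen (regs s (temp y)) <= q ->
  computes 2 (binop_code o x y) x
    (eval_binop o (regs s (temp x)) (regs s (temp y))) (same_but x y) s.
Proof.
move=> neq_xy code le_x le_y; have neq_xyF : (temp x == temp y) = false.
  by rewrite eq_temp; apply: negPf.
have le_sub : bitlen (regs s (temp y) - regs s (temp x)) <= q.
  exact: leq_trans (leq_bitlen (leq_subr _ _)) le_y.
exists (foldl effect s (binop_code o x y)).
  apply: (@reach_leq (size (binop_code o x y))); first by case: (o).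
  apply: reach_straight => //; first by case: (o).
  by case: (o); rewrite /= ?eqxx ?neq_xyF ?le_x ?le_y ?le_sub.
by case: (o); split; rewrite /= ?addn1 ?addn2 ?eqxx ?neq_xyF //;
  first [by lia | by move=> r /= /negPf-> | by move=> r /= /negPf-> /negPf->].
Qed.

Lemma slot_code_correct d a i s : code_at p (pc s) (slot_code d a) ->
  regs s (temp d) = i -> slot_bits (bitlen i) a <= q ->
  computes 4 (slot_code d a) d (slot a i) (same_but d d.+1) s.
Proof.
move=> code reg_i; rewrite /slot_bits => le_q.
have neq_d : (temp d == temp d.+1) = false by rewrite eq_temp; lia.
have neq_d' : (temp d.+1 == temp d) = false by rewrite eq_temp; lia.
have le_mul := bitlenM i stride.
exists (foldl effect s (slot_code d a)).
  apply: (@reach_straight s (slot_code d a)) => //.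
  rewrite /slot_code /= !eqxx ?neq_d ?neq_d' reg_i; lia.
split; rewrite /slot_code /= ?eqxx ?neq_d ?neq_d' ?reg_i //; first lia.
by move=> r /= /negPf-> /negPf->.
Qed.

Lemma bound_code_correct g d B s : bound_wf B ->
  code_at p (pc s) (bound_code d B) -> represents (regs s) g ->
  bitlen (eval_bound g B) <= q ->
  computes 2 (bound_code d B) d (eval_bound g B) (same_below d) s.
Proof.
move=> wf_B code rep le_B; exists (foldl effect s (bound_code d B)).
  apply: (@reach_leq (size (bound_code d B))); first by case: (B).
  apply: reach_straight => //; first by case: (B).
  case: B wf_B le_B code => //= a i lt_a le_B /code_at_cons[eq_i _].
  rewrite eqxx slot_neq_temp // rep // le_B andbT.
  by rewrite (@immediate_le (pc s)) // eq_i !inE eqxx orbT.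
case: B wf_B {le_B code} => [k|a i] /= lt_a.
  by split; rewrite /= ?addn1 ?eqxx //; apply: same_below_set.
split; rewrite /= ?addn2 ?eqxx ?slot_neq_temp ?rep //.
by move=> r /= /(_ d (leqnn d))/negPf->.
Qed.

Lemma loop_body_code off d B c : code_at p off (loop_code off d B c) ->
  code_at p (loop_body off d B) c.
Proof.
rewrite /loop_code => /code_at_cat[_ /code_at_cat[code _]].
by move: code; rewrite size_cat addnA addn3 /loop_body /loop_head addnS.
Qed.

Section Loop.
Variables (off d : nat) (B : bound) (c : seq instr) (g : memory).
Variables (T : nat) (inv : nat -> state -> Prop).
Local Notation N := (eval_bound g B).

Hypothesis wf_B : bound_wf B.
Hypothesis code : code_at p off (loop_code off d B c).
Hypothesis le_N : bitlen N <= q.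
Hypothesis inv_same : forall i s1 s2,
  same_below d.+1 (regs s1) (regs s2) -> inp s2 = inp s1 ->
  out s2 = out s1 -> inv i s1 -> inv i s2.
Hypothesis body_correct : forall i s1, i < N -> pc s1 = loop_body off d B ->
  regs s1 (temp d.+2) = i -> inv i s1 ->
  exists2 s2, reach T s1 s2 &
    [/\ pc s2 = pc s1 + size c, regs s2 (temp d.+1) = regs s1 (temp d.+1),
        regs s2 (temp d.+2) = i & inv i.+1 s2].

Let neq_temp d1 d2 : d1 != d2 -> (temp d1 == temp d2) = false.
Proof. by rewrite eq_temp => /negPf. Qed.

Let le_counter i : i <= N -> bitlen i <= q.
Proof. by move=> le_i; apply: leq_trans (leq_bitlen le_i) le_N. Qed.

Definition loop_state (i : nat) (s : state) : Prop :=
  [/\ regs s (temp d.+1) = N, regs s (temp d.+2) = i & inv i s].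

Lemma loop_test i s : i <= N -> pc s = loop_head off d B -> loop_state i s ->
  exists2 s', reach 2 s s' &
    pc s' = (if i < N then loop_body off d B else loop_exit off d B c) /\
    loop_state i s'.
Proof.
move=> le_i pcs [reg_N reg_i inv_i].
have [_ /code_at_cons[_ code_test]] := code_at_cat (proj1 (code_at_cat code)).
have {}code_test : code_at p (pc s)
    [:: Defs.Sub (temp d.+3) (temp d.+1) (temp d.+2);
        Jzero (temp d.+3) (loop_exit off d B c)].
  by rewrite pcs /loop_head addnS.
have [_ /code_at_cons[eq_jz _]] := code_at_cons code_test.
have le_sub : bitlen (N - i) <= q by rewrite le_counter ?leq_subr.
pose s1 := set_reg s (temp d.+3) (N - i).
have r1 : reach 1 s s1.
  have [code_sub _] := code_at_cat (c1 := [:: _]) code_test.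
  rewrite /s1 -reg_N -reg_i; apply: (reach_straight code_sub) => //=.
  by rewrite reg_N reg_i le_N le_counter.
exists (effect s1 (Jzero (temp d.+3) (loop_exit off d B c))).
  by apply: reach_trans r1 _; apply: reach_instr => //=; rewrite eqxx le_sub.
rewrite /= eqxx subn_eq0 leqNgt pcs; split; first by case: (i < N).
split; rewrite /= ?neq_temp //; try lia.
by apply: inv_same inv_i => //=; apply: (@same_below_set d.+1 d.+3); lia.
Qed.

Lemma loop_next i s : i < N -> pc s = loop_body off d B + size c ->
  regs s (temp d.+1) = N -> regs s (temp d.+2) = i -> inv i.+1 s ->
  exists2 s', reach 3 s s' & pc s' = loop_head off d B /\ loop_state i.+1 s'.
Proof.
move=> lt_i pcs reg_N reg_i inv_i.
have code_next : code_at p (pc s) ([:: Const (temp d.+3) 1;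
    Add (temp d.+2) (temp d.+2) (temp d.+3)] ++ [:: Jump (loop_head off d B)]).
  have [_ /code_at_cat[_]] := code_at_cat code.
  by rewrite size_cat addnA addn3 pcs /loop_body /loop_head addnS.
have [code_incr /code_at_cons[eq_jump _]] := code_at_cat code_next.
pose s1 := foldl effect s
  [:: Const (temp d.+3) 1; Add (temp d.+2) (temp d.+2) (temp d.+3)].
have neq23 : (temp d.+2 == temp d.+3) = false by rewrite neq_temp ?ltn_eqF.
exists (effect s1 (Jump (loop_head off d B))).
  apply: (reach_trans (T1 := 2)) (reach_instr _ _ _) => //=.
    apply: (reach_straight code_incr) => //=.
    by rewrite eqxx neq23 reg_i !le_counter ?(ltnW lt_i) ?(leq_trans _ lt_i).
  by rewrite -addn2.
split=> //; split; rewrite /= ?eqxx ?neq23 ?neq_temp ?reg_i ?addn1 //; try lia.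
apply: inv_same inv_i => //=; apply: (@same_but_below _ d.+2 d.+3); try lia.
by move=> r /= /negPf-> /negPf->.
Qed.

Lemma loop_iterate k i s : i + k = N -> pc s = loop_head off d B ->
  loop_state i s ->
  exists2 s', reach (k * (T + 5) + 2) s s' &
    pc s' = loop_exit off d B c /\ inv N s'.
Proof.
elim: k i s => [|k IH] i s eq_N pcs st_s; have le_i : i <= N by lia.
  have [s1 r1] := loop_test le_i pcs st_s.
  rewrite (_ : i = N) ?ltnn; last by lia.
  by case=> pc1 [_ _ inv1]; exists s1.
have lt_i : i < N by lia.
have [s1 r1] := loop_test le_i pcs st_s.
rewrite lt_i => -[pc1 [reg_N reg_i inv1]].
have [s2 r2 [pc2 reg2 reg2_i inv2]] := body_correct lt_i pc1 reg_i inv1.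
have [|s3 r3 [pc3 st3]] := loop_next lt_i _ (etrans reg2 reg_N) reg2_i inv2.
  by rewrite pc2 pc1.
have [|s4 r4 end4] := IH i.+1 s3 _ pc3 st3; first by lia.
exists s4 => //.
apply: reach_leq (reach_trans r1 (reach_trans r2 (reach_trans r3 r4))).
by rewrite mulSn; lia.
Qed.

Lemma loop_correct s : pc s = off -> represents (regs s) g -> inv 0 s ->
  exists2 s', reach (loop_steps N T) s s' &
    pc s' = pc s + size (loop_code off d B c) /\ inv N s'.
Proof.
move=> pcs rep inv0; have code_s := code; rewrite -pcs in code_s.
have [code_B /code_at_cons[eq_init _]] :=
  code_at_cat (proj1 (code_at_cat code_s)).
have [s1 r1 [pc1 in1 out1 reg1 same1]] :=
  bound_code_correct wf_B code_B rep le_N.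
pose s2 := set_reg s1 (temp d.+2) 0.
have r2 : reach 1 s1 s2.
  by apply: (@reach_instr s1 (Const _ _)); rewrite // pc1.
have [||s3 r3 [pc3 inv3]] := @loop_iterate N 0 s2 (add0n _).
- by rewrite /= pc1 pcs /loop_head addnS.
- split; rewrite /= ?eqxx ?neq_temp //; first lia.
  apply: inv_same inv0 => //=; apply: same_below_trans same1 _.
  exact: same_below_set.
exists s3.
  apply: reach_leq (reach_trans r1 (reach_trans r2 r3)).
  by rewrite /loop_steps; lia.
split=> //; rewrite pc3 pcs /loop_exit /loop_body /loop_head /loop_code.
by rewrite !size_cat /=; lia.
Qed.

End Loop.

Section Expressions.
Variables (b : nat) (g : memory).
Hypothesis b_gt0 : 0 < b.
Hypothesis g_bits : memory_bits_le b g.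

Definition env_stored (R : nat -> nat) (venv env : seq nat) : Prop :=
  forall v, v < size venv -> R (temp (nth 0 venv v)) = nth 0 env v.

Lemma env_stored_same d R R' venv env : all (ltn^~ d) venv ->
  same_below d R R' -> env_stored R venv env -> env_stored R' venv env.
Proof.
move=> lt_d same stored v lt_v; rewrite (same_below_temp same) ?stored //.
by apply: (allP lt_d); apply: mem_nth.
Qed.

Definition expr_spec (e : expr) : Prop := forall venv d env s,
  expr_wf (size venv) e -> all (ltn^~ d) venv ->
  code_at p (pc s) (expr_code (pc s) venv d e) ->
  represents (regs s) g -> env_stored (regs s) venv env ->
  bounded_by b g (loop_bounds e) -> word_bits_le b env -> work_bits b e <= q ->
  computes (expr_steps b e) (expr_code (pc s) venv d e) d (eval g env e)
    (same_below d) s.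

Lemma bitlen_eval_value e env : bounded_by b g (loop_bounds e) ->
  word_bits_le b env -> bitlen (eval g env e) <= value_bits b e.
Proof. by apply: bitlen_eval => // a i _; apply: g_bits. Qed.

Lemma bitlen_eval_work e env : bounded_by b g (loop_bounds e) ->
  word_bits_le b env -> bitlen (eval g env e) <= work_bits b e.
Proof.
move=> bounded le_env; apply: leq_trans (value_bits_le_work b e).
exact: bitlen_eval_value.
Qed.

Lemma lit_correct k : expr_spec (Lit k).
Proof.
move=> venv d env s _ _ code _ _ _ _ _; exists (set_reg s (temp d) k).
  exact: (reach_straight code).
split; rewrite /= ?addn1 ?eqxx //; exact: same_below_set.
Qed.

Lemma var_correct v : expr_spec (Var v).
Proof.
move=> venv d env s /= lt_v venv_d code _ stored _ le_env.
rewrite addn0 => le_q; pose dv := nth 0 venv v.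
have lt_dv : dv < d.
  by apply: (allP venv_d); apply: mem_nth.
have neq_dv : (temp dv == temp d) = false by rewrite eq_temp; lia.
exists (foldl effect s (expr_code (pc s) venv d (Var v))).
  apply: (reach_straight code) => //=; rewrite eqxx neq_dv stored //.
  rewrite (leq_trans (word_bits_le_nth _ b_gt0 le_env) le_q) !andbT.
  exact: leq_trans b_gt0 le_q.
split; rewrite /= ?addn2 ?eqxx ?neq_dv ?add0n ?stored //.
by apply: (@same_but_below _ d d) => // r /= /negPf-> _.
Qed.

Lemma entry_correct a e1 : expr_spec e1 -> expr_spec (Entry a e1).
Proof.
move=> IH venv d env s /= /andP[lt_a wf1] venv_d code rep stored bounded.
move=> le_env le_q.
have [code1 code2] := code_at_cat code.
apply: (computes_trans (T2 := 4 + 1) (c2 := slot_code d a ++ _)).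
  by apply: (IH venv d env) => //; lia.
move=> s1 pc1 reg1 same1; rewrite -pc1 in code2.
have [code_slot code_fetch] := code_at_cat (c1 := slot_code d a) code2.
have le_i := bitlen_eval_value bounded le_env.
apply: computes_trans (slot_code_correct code_slot reg1 _) _.
  by rewrite /slot_bits in le_q *; lia.
move=> s2 pc2 reg2 same2; rewrite -pc2 in code_fetch.
have rep2 : represents (regs s2) g.
  apply: represents_same rep; apply: same_below_trans same1 _.
  exact: same_but_below same2.
exists (foldl effect s2 [:: Fetch (temp d) (temp d)]).
  apply: (reach_straight code_fetch) => //=; rewrite reg2 rep2 // andbT.
  apply/andP; split.
    by apply: leq_trans (bitlen_slot _ le_i) _; lia.
  by apply: leq_trans (g_bits _ _) _; lia.
split; rewrite /= ?addn1 ?eqxx ?reg2 ?rep2 //.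
apply: same_below_trans same1 _; apply: (@same_but_below _ d d.+1) => // r.
by move=> r_d r_d1; rewrite /= (negPf r_d) same2.
Qed.

Lemma binop_correct o e1 e2 :
  expr_spec e1 -> expr_spec e2 -> expr_spec (Binop o e1 e2).
Proof.
move=> IH1 IH2 venv d env s /= /andP[wf1 wf2] venv_d code rep stored.
rewrite bounded_by_cat => /andP[bounded1 bounded2] le_env le_q.
have [code1 code2] := code_at_cat code.
have venv_d1 : all (ltn^~ d.+1) venv by apply: sub_all venv_d => x /= /ltnW.
apply: (computes_trans (T1 := expr_steps b e1)).
  by apply: (IH1 venv d env) => //; lia.
move=> s1 pc1 reg1 same1; rewrite -pc1 in code2 *.
have [code21 code22] := code_at_cat code2.
apply: (computes_trans (T1 := expr_steps b e2)).
  apply: (IH2 venv d.+1 env) => //; last by lia.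
    exact: represents_same same1 rep.
  exact: env_stored_same same1 stored.
move=> s2 pc2 reg2 same2; rewrite -pc2 in code22.
have reg12 : regs s2 (temp d) = eval g env e1.
  by rewrite (same_below_temp same2).
have le1 := bitlen_eval_work bounded1 le_env.
have le2 := bitlen_eval_work bounded2 le_env.
have [|||s3 r3 [pc3 in3 out3 reg3 same3]] :=
  @binop_code_correct o d d.+1 s2 _ code22; rewrite ?reg12 ?reg2; try lia.
exists s3 => //; split=> //; first by rewrite reg3 reg12 reg2.
apply: same_below_trans same1 _.
apply: same_below_trans (same_below_leq (leqnSn d) same2) _.
exact: same_but_below same3.
Qed.

Definition bigop_inv (k : aggregate) (d : nat) (F : nat -> nat) (s : state)
    (i : nat) (s' : state) : Prop :=
  [/\ inp s' = inp s, out s' = out s, regs s' (temp d) = eval_agg k i F &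
      same_below d (regs s) (regs s')].

Lemma bigop_body_correct k e1 venv d env s i s1 :
  let c := expr_code (pc s1) (d.+2 :: venv) d.+3 e1 ++
           binop_code (agg_binop k) d d.+3 in
  let F := fun i => eval g (i :: env) e1 in
  expr_spec e1 -> expr_wf (size venv).+1 e1 -> all (ltn^~ d) venv ->
  represents (regs s) g -> env_stored (regs s) venv env ->
  bounded_by b g (loop_bounds e1) -> word_bits_le b (i :: env) ->
  work_bits b e1 <= q -> bitlen (eval_agg k i F) <= q ->
  code_at p (pc s1) c -> regs s1 (temp d.+2) = i -> bigop_inv k d F s i s1 ->
  exists2 s2, reach (expr_steps b e1 + 2) s1 s2 &
    [/\ pc s2 = pc s1 + size c, regs s2 (temp d.+1) = regs s1 (temp d.+1),
        regs s2 (temp d.+2) = i & bigop_inv k d F s i.+1 s2].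
Proof.
move=> c F IH wf1 venv_d rep stored bounded le_env le_q le_agg code reg_i.
case=> in1 out1 reg1 same1; have [code1 code2] := code_at_cat code.
have venv_d3 : all (ltn^~ d.+3) (d.+2 :: venv).
  by rewrite /= ltnS leqnn; apply: sub_all venv_d => x /=; lia.
have stored1 : env_stored (regs s1) (d.+2 :: venv) (i :: env).
  case=> [|v] //=; rewrite ltnS.
  exact: (env_stored_same venv_d same1 stored).
have [s2 r2 [pc2 in2 out2 reg2 same2]] :=
  IH (d.+2 :: venv) _ _ _ wf1 venv_d3 code1
  (represents_same same1 rep) stored1 bounded le_env le_q.
have kept d' : d' < d.+3 -> regs s2 (temp d') = regs s1 (temp d').
  exact: same_below_temp.
have reg2d : regs s2 (temp d) = eval_agg k i F by rewrite kept //; lia.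
rewrite -pc2 in code2; have le_F := bitlen_eval_work bounded le_env.
have [|||s3 r3 [pc3 in3 out3 reg3 same3]] := binop_code_correct _ code2;
  rewrite ?reg2 ?reg2d //; try lia.
exists s3; first exact: reach_trans r2 r3.
have neq d1 d2 : d1 != d2 -> temp d1 != temp d2 by rewrite eq_temp.
split.
- by rewrite pc3 pc2 size_cat addnA.
- by rewrite same3 ?kept ?neq //; lia.
- by rewrite same3 ?kept ?neq //; lia.
split; rewrite ?in3 ?in2 ?out3 ?out2 // ?reg3 ?reg2 ?reg2d ?eval_aggS //.
apply: same_below_trans same1 _.
apply: same_below_trans (same_below_leq _ same2) _; first lia.
by apply: same_but_below same3; lia.
Qed.

Lemma bigop_correct k B e1 : expr_spec e1 -> expr_spec (Bigop k B e1).
Proof.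
move=> IH venv d env s /= /andP[wf_B wf1] venv_d /code_at_cons[eq_init code].
move=> rep stored /andP[le_B bounded] le_env le_q.
pose F i := eval g (i :: env) e1; pose N := eval_bound g B.
have le_env_i i : i < N -> word_bits_le b (i :: env).
  move=> lt_i; rewrite /= le_env andbT.
  exact: leq_trans (bitlen_ltn lt_i) le_B.
have le_agg i : i < N -> bitlen (eval_agg k i F) <= q.
  move=> lt_i; apply: leq_trans (bitlen_agg _ (b := value_bits b e1) _) _.
    by move=> j lt_j; apply: bitlen_eval_value (le_env_i j _); lia.
  have : i * value_bits b e1 <= b * value_bits b e1.
    by rewrite leq_mul2r (leq_trans (ltnW lt_i)) ?orbT.
  lia.
pose s1 := set_reg s (temp d) (agg_unit k).
have r1 : reach 1 s s1 by apply: (@reach_instr s (Const _ _)).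
have same1 : same_below d (regs s) (regs s1) by apply: same_below_set.
have le_N : bitlen N <= q by apply: leq_trans (bitlen_ltn (ltnSn _)) _; lia.
have [||||s2 r2 [pc2 [in2 out2 reg2 same2]]] :=
  loop_correct (g := g) (s := s1) (T := expr_steps b e1 + 2)
    (inv := bigop_inv k d F s) wf_B code le_N _ _ erefl.
- move=> i s2 s3 same23 in23 out23 [in2 out2 reg2 same2].
  split; rewrite ?in23 ?out23 ?(same_below_temp same23) //.
  exact: same_below_trans same2 (same_below_leq _ same23).
- move=> i s2 lt_i pc2 reg_i inv_i.
  have := @bigop_body_correct k e1 venv d env s i s2; rewrite pc2; apply => //.
  + exact: le_env_i.
  + lia.
  + exact: le_agg.
  + exact: loop_body_code code.
- exact: represents_same same1 rep.
- by split=> //=; rewrite ?eqxx ?eval_agg0.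
exists s2; last by split; rewrite // pc2 /= addSnnS.
apply: reach_leq (reach_trans r1 r2).
by rewrite leq_add2l leq_loop_steps.
Qed.

Lemma expr_correct e : expr_spec e.
Proof.
elim: e => [k|v|a e IH|o e1 IH1 e2 IH2|k B e IH].
- exact: lit_correct.
- exact: var_correct.
- exact: entry_correct.
- exact: binop_correct.
- exact: bigop_correct.
Qed.

End Expressions.

Section Statement.
Variables (b a : nat) (st : stmt) (w : word) (g : memory).
Local Notation N := (eval_bound g (stmt_bound st)).
Local Notation filled := (fill st w a g).

Hypothesis b_gt0 : 0 < b.
Hypothesis lt_a : a.+1 < stride.
Hypothesis wf_st : stmt_wf st.
Hypothesis g_blank : forall i, g a i = 0.
Hypothesis filled_bits : memory_bits_le b (filled N).
Hypothesis filled_bounds : bounded_by b (filled N) (stmt_bounds st).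
Hypothesis le_q : stmt_work b a st <= q.

Let filled_le i : i <= N -> memory_le (filled i) (filled N).
Proof.
move=> le_i a' j; rewrite !fill_entry; have [->|//] := eqVneq a' a.
by case: ltnP => [lt_j|_] /=; rewrite ?(leq_trans lt_j le_i) // g_blank.
Qed.

Let filled_i_bits i : i <= N -> memory_bits_le b (filled i).
Proof. by move/filled_le/memory_bits_le_trans; apply. Qed.

Let N_le : N <= b.
Proof.
apply: leq_trans (eval_bound_le (stmt_bound st) (filled_le (leq0n N))) _.
by move: filled_bounds; case: (st) => [B|B e] /andP[].
Qed.

Let counter_le i : i < N -> word_bits_le b [:: i].
Proof. by move=> lt_i; rewrite /= (leq_trans (bitlen_ltn lt_i)). Qed.

Let entry_le i : i < N -> bitlen (stmt_entry st w (filled i) i) <= b.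
Proof.
by move=> lt_i; have := filled_bits a i; rewrite fill_entry eqxx lt_i.
Qed.

Lemma entry_code_correct i s : i < N ->
  code_at p (pc s) (entry_code (pc s) st) -> represents (regs s) (filled i) ->
  inp s = unread st w i -> regs s (temp 2) = i ->
  exists2 s', reach (entry_steps b st) s s' &
    [/\ pc s' = pc s + size (entry_code (pc s) st), inp s' = unread st w i.+1,
        out s' = out s, regs s' (temp 3) = stmt_entry st w (filled i) i &
        same_below 3 (regs s) (regs s')].
Proof.
move=> lt_i; have := entry_le lt_i; have := filled_i_bits (ltnW lt_i).
have := filled_le (ltnW lt_i).
move: le_q wf_st filled_bounds; rewrite /stmt_work.
case: (st) => [B|B e] /= le_w wf_e bounds le_fill bits_i le_v code rep inp_s reg_i.
  have head_inp : head 0 (inp s) = nth 0 w i.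
    by rewrite inp_s -nth0 nth_drop addn0.
  exists (effect s (Read (temp 3))).
    by apply: (reach_straight code); rewrite //= head_inp andbT; lia.
  split; rewrite /= ?addn1 ?eqxx //; first by rewrite inp_s -drop1 drop_drop.
  exact: (@same_below_set 3 3).
have [_ wf1] := andP wf_e; have [_ bounds1] := andP bounds.
have [|||s' r' [pc' in' out' reg' same']] :=
  expr_correct (venv := [:: 2]) (d := 3) (env := [:: i])
    b_gt0 bits_i wf1 isT code rep _ _ (counter_le lt_i).
- by case.
- exact: bounded_by_le le_fill bounds1.
- by lia.
by exists s' => //; split; rewrite ?in' ?inp_s.
Qed.

Lemma store_code_correct i s : i < N ->
  code_at p (pc s) (store_code a) -> represents (regs s) (filled i) ->
  regs s (temp 2) = i -> regs s (temp 3) = stmt_entry st w (filled i) i ->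
  exists2 s', reach 7 s s' &
    [/\ pc s' = pc s + size (store_code a), inp s' = inp s, out s' = out s,
        represents (regs s') (filled i.+1) &
        forall d, d < 4 -> regs s' (temp d) = regs s (temp d)].
Proof.
move=> lt_i code rep reg_i reg_v; have le_work := le_q.
rewrite /stmt_work in le_work.
have [code_copy code2] := code_at_cat code.
have [||s1 r1 [pc1 in1 out1 reg1 same1]] :=
  expr_correct (e := Var 0) (venv := [:: 2]) (d := 4) (env := [:: i]) b_gt0
    (filled_i_bits (ltnW lt_i)) isT isT code_copy rep _ isT (counter_le lt_i).
- by case.
- by rewrite /=; lia.
have [code_slot code_store] := code_at_cat (c1 := slot_code 4 a) code2.
rewrite -pc1 in code_slot code_store.
have le_i : bitlen i <= b by have /andP[] := counter_le lt_i.
have [|s2 r2 [pc2 in2 out2 reg2 same2]] := slot_code_correct code_slot reg1.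
  by rewrite /slot_bits in le_work *; rewrite /=; lia.
rewrite -pc2 in code_store.
have same12 : same_below 4 (regs s) (regs s2).
  exact: same_below_trans same1 (same_but_below _ _ same2).
have reg3 : regs s2 (temp 3) = stmt_entry st w (filled i) i.
  by rewrite (same_below_temp same12).
exists (effect s2 (Store (temp 4) (temp 3))).
  apply: reach_trans r1 (reach_trans (T2 := 1) r2 _).
  apply: (reach_straight code_store) => //=; rewrite reg2 reg3 andbT.
  apply/andP; split; first by apply: leq_trans (bitlen_slot a le_i) _; lia.
  by apply: leq_trans (entry_le lt_i) _; lia.
split; rewrite /= ?pc2 ?pc1 ?in2 ?out2 ?reg2 ?reg3 //.
- by rewrite /=; lia.
- by move=> a' i' lt_a'; rewrite /= eq_slot // (represents_same same12 rep).
- move=> d lt_d; rewrite /= eq_sym slot_neq_temp //.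
  exact: same_below_temp same12 _.
Qed.

Lemma stmt_code_correct s :
  code_at p (pc s) (stmt_code (pc s) a st) ->
  represents (regs s) g -> inp s = w ->
  exists2 s', reach (stmt_steps b st) s s' &
    [/\ pc s' = pc s + size (stmt_code (pc s) a st), inp s' = unread st w N,
        out s' = out s & represents (regs s') (filled N)].
Proof.
move=> code rep inp_s.
have wf_B : bound_wf (stmt_bound st) by case: (st) wf_st => [//|B e] /andP[].
have le_N : bitlen N <= q.
  have := le_q; rewrite /stmt_work => le_work.
  by apply: leq_trans (bitlen_ltn (ltnSn _)) _; lia.
pose inv i s' := [/\ represents (regs s') (filled i),
  inp s' = unread st w i & out s' = out s].
have [| | | |s1 r1 [pc1 [rep1 in1 out1]]] :=
  loop_correct (g := g) (s := s) (inv := inv) (T := entry_steps b st + 7)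
    wf_B code le_N _ _ erefl.
- move=> i s1 s2 same12 in12 out12 [rep1 in1 out1].
  split; rewrite ?in12 ?out12 //.
  exact: represents_same same12 rep1.
- move=> i s1 lt_i pc1 reg1 [rep1 in1 out1]; have := loop_body_code code.
  rewrite -pc1 => /code_at_cat[code_e code_s].
  have [s2 r2 [pc2 in2 out2 reg2 same2]] :=
    entry_code_correct lt_i code_e rep1 in1 reg1.
  rewrite -pc2 in code_s.
  have [|s3 r3 [pc3 in3 out3 rep3 same3]] :=
      store_code_correct lt_i code_s (represents_same same2 rep1) _ reg2.
    by rewrite (same_below_temp same2).
  exists s3; first exact: reach_trans r2 r3.
  rewrite !same3 // !(same_below_temp same2) // pc3 pc2 pc1 size_cat addnA.
  by split=> //; split; rewrite ?in3 ?out3 ?out2.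
- by [].
- by split=> //; rewrite inp_s; case: (st) => //= B; rewrite drop0.
exists s1 => //; apply: reach_leq r1.
exact: leq_loop_steps.
Qed.

End Statement.

Lemma prog_code_correct b a g w ss s : 0 < b ->
  let M := (run a g w ss).1 in
  a + size ss < stride -> all stmt_wf ss ->
  (forall a', a <= a' -> g a' =1 fun=> 0) ->
  memory_bits_le b M -> bounded_by b M (prog_bounds ss) ->
  prog_work b a ss <= q ->
  code_at p (pc s) (prog_code (pc s) a ss) ->
  represents (regs s) g -> inp s = w ->
  exists2 s', reach (prog_steps b ss) s s' &
    [/\ pc s' = pc s + size (prog_code (pc s) a ss), out s' = out s &
        represents (regs s') M].
Proof.
move=> b_gt0; elim: ss a g w s => [|st ss IH] a g w s /= lt_stride.
  by move=> _ _ _ _ _ _ rep _; exists s; rewrite ?addn0 //; apply: reach_refl.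
case/andP=> wf_st wf_ss g_after; set g1 := fill _ _ _ _ _.
set w1 := unread _ _ _; move=> M_bits.
rewrite /prog_bounds /= bounded_by_cat => /andP[bounds_st bounds_ss].
move=> le_q /code_at_cat[code_st code_ss] rep inp_s.
have g1_after b' : a.+1 <= b' -> g1 b' =1 fun=> 0.
  by move=> lt_b' i; rewrite /g1 fill_other ?gtn_eqF // g_after // ltnW.
have g1_le := run_ge w1 ss g1_after.
have [|||||s1 r1 [pc1 in1 out1 rep1]] :=
  @stmt_code_correct b a st w g b_gt0 _ wf_st _ _ _ _ s code_st rep inp_s.
- by lia.
- exact: g_after.
- exact: memory_bits_le_trans g1_le M_bits.
- exact: bounded_by_le g1_le bounds_st.
- lia.
rewrite -pc1 in code_ss *.
have [||s2 r2 [pc2 out2 rep2]] :=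
  IH a.+1 g1 w1 s1 _ wf_ss g1_after M_bits bounds_ss _ code_ss rep1 in1.
- by rewrite addSnnS.
- lia.
exists s2; first exact: reach_trans r1 r2.
by rewrite pc2 out2 pc1 size_cat addnA.
Qed.

Lemma output_code_correct b a g B s : 0 < b -> a.+1 < stride -> bound_wf B ->
  memory_bits_le b g -> eval_bound g B <= b ->
  output_work b a <= q ->
  code_at p (pc s) (output_code (pc s) a B) -> represents (regs s) g ->
  out s = [::] ->
  exists2 s', reach (output_steps b a) s s' &
    pc s' = pc s + size (output_code (pc s) a B) /\
    out s' = mkseq (g a) (eval_bound g B).
Proof.
move=> b_gt0 lt_a wf_B g_bits le_B; rewrite /output_work => le_q code rep out_s.
have le_N : bitlen (eval_bound g B) <= q.
  by apply: leq_trans (bitlen_ltn (ltnSn _)) _; lia.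
pose inv i s' := represents (regs s') g /\ out s' = mkseq (g a) i.
have [| | | |s1 r1 [pc1 [_ out1]]] :=
  loop_correct (g := g) (s := s) (inv := inv)
    (T := expr_steps b (Entry a (Var 0)) + 1) wf_B code le_N _ _ erefl.
- move=> i s1 s2 same12 _ out12 [rep1 out1]; split; rewrite ?out12 //.
  exact: represents_same same12 rep1.
- move=> i s1 lt_i pc1 reg1 [rep1 out1]; have := loop_body_code code.
  rewrite -pc1 => /code_at_cat[code_e code_w].
  have [||||s2 r2 [pc2 in2 out2 reg2 same2]] :=
      expr_correct (venv := [:: 2]) (d := 3) (env := [:: i])
        b_gt0 g_bits _ isT code_e rep1 _ isT.
  + by rewrite /= lt_a.
  + by case.
  + by rewrite /= (leq_trans (bitlen_ltn lt_i)).
  + lia.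
  rewrite -pc2 in code_w; exists (effect s2 (Write (temp 3))).
    apply: reach_trans r2 _; apply: (reach_straight code_w) => //=.
    by rewrite reg2 andbT; apply: leq_trans (g_bits _ _) _; lia.
  rewrite !(same_below_temp same2) // pc1 size_cat addnA addn1 -pc1 -pc2.
  split=> //; split; first exact: represents_same same2 rep1.
  by rewrite /= out2 out1 reg2 /= /mkseq -addn1 iotaD map_cat cats1.
- by [].
- by split; rewrite // out_s.
exists s1; last by [].
by apply: reach_leq r1; apply: leq_loop_steps.
Qed.

End Execution.

Theorem compile_correct ss B b w :
  let M := (run 0 blank w ss).1 in
  0 < b -> 0 < size ss < stride -> all stmt_wf ss -> bound_wf B ->
  memory_bits_le b M -> bounded_by b M (B :: prog_bounds ss) ->
  exists2 t, t <= compile_time ss B b &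
    outputs_in (compile ss B) w t (mkseq (M (size ss).-1) (eval_bound M B)).
Proof.
move=> M b_gt0 /andP[ss_gt0 lt_ss] wf_ss wf_B M_bits /andP[le_B bounds].
set p := compile ss B; set a := (size ss).-1; set c := prog_code 0 0 ss.
pose q := static_bits p + prog_work b 0 ss + output_work b a.
have static_le : static_bits p <= q by rewrite /q; lia.
have [code1 code2] :
    code_at p 0 c /\ code_at p (0 + size c) (output_code (size c) a B).
  exact: code_at_cat.
have [//||//|s1 r1 [pc1 out1 rep1]] :=
  prog_code_correct (a := 0) (g := blank) (w := w) (s := init_state w)
    static_le b_gt0 lt_ss wf_ss _ M_bits bounds _ code1 _ erefl.
  by rewrite /q; lia.
rewrite /= add0n in pc1; rewrite add0n -pc1 in code2.
have [||s2 r2 [pc2 out2]] :=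
  output_code_correct static_le b_gt0 _ wf_B M_bits le_B _ code2 rep1 out1.
- by rewrite /a; lia.
- by rewrite /q; lia.
have [t le_t star_t] := reach_trans r1 r2; exists t => //; exists s2 => //.
apply: star_runs star_t _.
by rewrite /step pc2 nth_default // /p /compile size_cat pc1.
Qed.

(** * The local-ratio argument *)

Section LocalRatio.
Variables (n s horizon : nat) (time : nat -> nat) (charge : nat -> nat -> nat).
Variable w : nat -> nat.

(* Residual weights, scaled by a further factor [s] at each step: at step
   [time j] the column [j] charges the others. *)
Fixpoint residual (t j : nat) : nat :=
  if t is t'.+1 then
    s * residual t' j -
    \sum_(j' < n | time j' == t') residual t' j' * charge j' j
  else w j.

Lemma residualS t j : residual t.+1 j =
  s * residual t j - \sum_(j' < n | time j' == t) residual t j' * charge j' j.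
Proof. by []. Qed.

Arguments residual : simpl never.

Definition active (j : nat) : bool := 0 < residual (time j) j.

Definition later (j : nat) (z : nat -> nat) : nat :=
  s * z j + \sum_(j' < n | time j < time j') charge j j' * z j'.

Lemma residual_gt0 t t' j : t <= t' -> 0 < residual t' j -> 0 < residual t j.
Proof.
move/subnKC <-; elim: (t' - t) => [|k IH]; first by rewrite addn0.
rewrite addnS residualS => /leq_trans/(_ (leq_subr _ _)).
by rewrite muln_gt0 => /andP[_ /IH].
Qed.

Lemma active_weight_gt0 j : active j -> 0 < w j.
Proof. exact: residual_gt0 (leq0n _). Qed.

Variables (x y : nat -> nat) (C : nat).
Hypothesis s_gt0 : 0 < s.
Hypothesis time_inj : forall j j', j < n -> j' < n -> time j = time j' ->
  j = j'.
Hypothesis time_lt : forall j, j < n -> time j < horizon.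
Hypothesis x_active : forall j, j < n -> 0 < x j -> active j.
Hypothesis later_ratio : forall j, j < n -> active j ->
  later j y <= C * later j x.

Let potential (t : nat) (z : nat -> nat) : nat :=
  \sum_(j < n | t <= time j) residual t j * z j.

Let potential_idle t z : (forall j, j < n -> time j != t) ->
  s * potential t z = potential t.+1 z.
Proof.
move=> idle; rewrite /potential big_distrr /=; apply: eq_big => j.
  by rewrite leq_eqVlt eq_sym (negPf (idle j _)) ?ltn_ord.
move=> _; rewrite mulnA residualS big_pred0 ?subn0 // => j'.
by rewrite (negPf (idle j' _)).
Qed.

Let time_eq (j : 'I_n) (j' : 'I_n) : (time j == time j') = (j == j').
Proof.
by apply/eqP/eqP => [/(time_inj (ltn_ord j) (ltn_ord j'))/val_inj|->].
Qed.

Let potential_split (j : 'I_n) z :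
  potential (time j) z = residual (time j) j * z j +
    \sum_(j' < n | time j < time j') residual (time j) j' * z j'.
Proof.
rewrite /potential (bigD1 j) //=; congr (_ + _); apply: eq_bigl => j'.
by rewrite ltn_neqAle time_eq eq_sym andbC.
Qed.

Let residual_charged (j : 'I_n) j' :
  residual (time j).+1 j' =
  s * residual (time j) j' - residual (time j) j * charge j j'.
Proof.
by rewrite residualS (eq_bigl (pred1 j)) ?big_pred1_eq // => l; rewrite time_eq.
Qed.

Let potential_le (j : 'I_n) z :
  s * potential (time j) z <=
  potential (time j).+1 z + residual (time j) j * later j z.
Proof.
rewrite potential_split /later /potential !mulnDr !big_distrr /=.
rewrite mulnCA addnCA leq_add2l -big_split /=; apply: leq_sum => j' _.
rewrite residual_charged [s * _]mulnA [residual _ j * (charge _ _ * _)]mulnA.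
by rewrite -mulnDl leq_mul2r; apply/orP; right; lia.
Qed.

Let potential_ge (j : 'I_n) :
  potential (time j).+1 x + residual (time j) j * later j x <=
  s * potential (time j) x.
Proof.
rewrite potential_split /later /potential !mulnDr !big_distrr /=.
rewrite [s * (_ * _)]mulnCA addnCA leq_add2l -big_split /=.
apply: leq_sum => j' lt_t.
have [->|x_gt0] := posnP (x j'); first by rewrite !muln0.
rewrite [s * _]mulnA [residual _ j * (charge _ _ * _)]mulnA -mulnDl leq_mul2r.
apply/orP; right.
have := residual_gt0 lt_t (x_active (ltn_ord j') x_gt0).
by rewrite residual_charged; lia.
Qed.

Lemma local_ratio : \sum_(j < n) w j * y j <= C * \sum_(j < n) w j * x j.
Proof.
suff ratio k t : t + k = horizon -> potential t y <= C * potential t x.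
  by have := ratio horizon 0 (add0n _); rewrite /potential /=.
elim: k t => [|k IH] t def_t.
  rewrite /potential big_pred0 // => j.
  by rewrite leqNgt -(addn0 t) def_t time_lt.
have {}IH : potential t.+1 y <= C * potential t.+1 x
  by apply: IH; rewrite addSnnS.
rewrite -(leq_pmul2l s_gt0) mulnCA.
have [/existsP[j /eqP time_j]|/existsPn idle] :=
  boolP [exists j : 'I_n, time j == t].
  rewrite -time_j in IH *; apply: leq_trans (potential_le _ _) _.
  apply: leq_trans _ (leq_mul (leqnn C) (potential_ge _)).
  rewrite mulnDr; apply: leq_add IH _; rewrite [C * (_ * _)]mulnCA leq_mul2l.
  have [//|active_j] := posnP (residual (time j) j).
  exact: later_ratio.
by rewrite !potential_idle // => j lt_j; apply: (idle (Ordinal lt_j)).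
Qed.

End LocalRatio.

Arguments residual : simpl never.

Lemma first_fit K (p : pred nat) (T : nat -> nat) :
  (forall k, k < K -> T k = p k && (\sum_(k' < K | k' < k) T k' == 0) :> nat) ->
  (exists k : 'I_K, p k) ->
  exists k0 : 'I_K, [/\ p k0, T k0 = 1 & forall k : 'I_K, k != k0 -> T k = 0].
Proof.
move=> T_eq [k1 pk1].
have ex_p : exists k, (k < K) && p k by exists k1; rewrite ltn_ord.
case: (ex_minnP ex_p) => k /andP[lt_k pk] min_k.
have before k' : k' < k -> T k' = 0.
  move=> lt_kk; rewrite T_eq ?(ltn_trans lt_kk) //.
  case: (boolP (p k')) => [pk'|] //=.
  have := min_k k'; rewrite (ltn_trans lt_kk) // pk' leqNgt lt_kk.
  by move/(_ isT).
have Tk : T k = 1 by rewrite T_eq // pk big1 // => k' lt_k'; rewrite before.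
exists (Ordinal lt_k); split=> // k' neq_k.
case: (ltngtP k' k) => [|lt_kk|eq_k]; first exact: before; last first.
  by case/eqP: neq_k; apply: val_inj.
by rewrite T_eq // (bigD1 (Ordinal lt_k)) //= Tk andbF.
Qed.

Lemma leq_sum_term n (p : pred 'I_n) (F : 'I_n -> nat) j :
  p j -> F j <= \sum_(i < n | p i) F i.
Proof. by move=> pj; rewrite (bigD1 j) //= leq_addr. Qed.

Lemma leq_sum_sub n (p q : pred 'I_n) (F G : 'I_n -> nat) :
  (forall j, p j -> 0 < F j -> q j /\ F j <= G j) ->
  \sum_(j < n | p j) F j <= \sum_(j < n | q j) G j.
Proof.
move=> le_FG; rewrite big_mkcond [leqRHS]big_mkcond /=; apply: leq_sum => j _.
case: ifP => // pj; have [->//|F_gt0] := posnP (F j).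
by have [-> ->] := le_FG j pj F_gt0.
Qed.

Lemma sum_ltnS n t (F : nat -> nat) : t < n ->
  \sum_(j < n | j < t.+1) F j = \sum_(j < n | j < t) F j + F t.
Proof.
move=> lt_t; rewrite (bigD1 (Ordinal lt_t)) //= addnC; congr (_ + _).
by apply: eq_bigl => j; rewrite ltnS [RHS]ltn_neqAle andbC.
Qed.

Lemma sum_leq_ltn n t (F : nat -> nat) : t < n ->
  \sum_(j < n | t <= j) F j = F t + \sum_(j < n | t < j) F j.
Proof.
move=> lt_t; rewrite (bigD1 (Ordinal lt_t)) //=; congr (_ + _).
by apply: eq_bigl => j; rewrite [RHS]ltn_neqAle andbC eq_sym.
Qed.

Lemma sum_ltn_ord n (F : nat -> nat) :
  \sum_(j < n | j < n) F j = \sum_(j < n) F j.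
Proof. by apply: eq_bigl => j; rewrite ltn_ord. Qed.

(** * Rounding *)

Section Columns.
Variables (m n K P : nat) (E : nat -> nat -> nat) (u c : nat -> nat).

Definition row_load (p : pred nat) (z : nat -> nat) (i : nat) : nat :=
  \sum_(j < n | p j) z j * E i j.

Definition col_support (j : nat) : {set 'I_m} := [set i : 'I_m | 0 < E i j].
Definition col_max (j : nat) : nat := \max_(i < m) E i j.
Definition is_big (j : nat) : bool := P < 2 * col_max j.
Definition time_of (j : nat) : nat := is_big j * n + j.
Definition gain (j : nat) : nat := if is_big j then 2 * K else u j.
Definition charge (j j' : nat) : nat :=
  gain j * \sum_(i in col_support j) E i j'.
Definition weight (j : nat) : nat := c j * (0 < u j).
Definition flagged (j : nat) : bool := active n (P * K) time_of charge weight j.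
Definition later_value (j : nat) (z : nat -> nat) : nat :=
  later n (P * K) time_of charge j z.

Lemma row_loadD p z z' i :
  row_load p (fun j => z j + z' j) i = row_load p z i + row_load p z' i.
Proof. by rewrite -big_split; apply: eq_bigr => j _; rewrite mulnDl. Qed.

Lemma leq_row_load (p q : pred nat) z z' i :
  (forall j, j < n -> p j -> 0 < z j -> 0 < E i j -> q j /\ z j <= z' j) ->
  row_load p z i <= row_load q z' i.
Proof.
move=> le_z; apply: leq_sum_sub => j pj; rewrite muln_gt0 => /andP[z_gt0 E_gt0].
by have [-> le_zj] := le_z j (ltn_ord j) pj z_gt0 E_gt0;
  rewrite leq_mul2r le_zj orbT.
Qed.

Lemma leq_row_load_term (p : pred nat) z i j : j < n -> p j ->
  z j * E i j <= row_load p z i.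
Proof.
move=> lt_j pj.
exact: (leq_sum_term (p := p) (fun j => z j * E i j) (j := Ordinal lt_j)).
Qed.

Lemma row_load_all z i : row_load (fun j => j < n) z i = row_load predT z i.
Proof. exact: (sum_ltn_ord n (fun j => z j * E i j)). Qed.

Lemma in_col_support i j : (i \in col_support j) = (0 < E i j).
Proof. by rewrite inE. Qed.

Lemma bigP j : is_big j -> exists i : 'I_m, P < 2 * E i j.
Proof.
move=> big_j; apply/existsP; apply: contraTT big_j => /existsPn no_i.
rewrite /is_big -leqNgt /col_max.
suff : \max_(i < m) E i j <= P %/ 2 by lia.
by apply/bigmax_leqP => i _; have := no_i i; lia.
Qed.

Lemma smallP j (i : 'I_m) : ~~ is_big j -> 2 * E i j <= P.
Proof.
rewrite /is_big -leqNgt; apply: leq_trans; rewrite leq_mul2l /= /col_max.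
exact: (leq_bigmax_cond (F := fun i : 'I_m => E i j)).
Qed.

Lemma time_of_inj j j' : j < n -> j' < n -> time_of j = time_of j' -> j = j'.
Proof. by rewrite /time_of; do 2!case: is_big; lia. Qed.

Lemma time_of_lt j : j < n -> time_of j < 2 * n.
Proof. by rewrite /time_of; case: is_big; lia. Qed.

Lemma flagged_u_gt0 j : flagged j -> 0 < u j.
Proof. by move/active_weight_gt0; rewrite /weight muln_gt0 lt0b => /andP[]. Qed.

Lemma later_valueE j z : later_value j z =
  P * K * z j +
  gain j *
  \sum_(i in col_support j) row_load (fun j' => time_of j < time_of j') z i.
Proof.
rewrite /later_value /later; congr (_ + _).
under [LHS]eq_bigr => j' _ do rewrite /charge -mulnA big_distrl /=.
rewrite -big_distrr exchange_big /=; congr (_ * _); apply: eq_bigr => i _.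
by apply: eq_bigr => j' _; rewrite mulnC.
Qed.

End Columns.

Section Selection.
Variables (m n K P : nat) (E : nat -> nat -> nat) (u c : nat -> nat).
Variables (accepted : nat -> nat) (assigned copies : nat -> nat -> nat).
Local Notation load := (row_load n E).
Local Notation col_support := (col_support m E).
Local Notation big := (is_big m P E).
Local Notation time := (time_of m n P E).
Local Notation flag := (flagged m n K P E u c).

Definition accepts (j : nat) : bool :=
  [&& flag j, big j &
      [forall i in col_support j, 2 * load (fun j' => j < j') accepted i <= P]].

Definition class_fits (j k : nat) : bool :=
  [forall i : 'I_m, load (fun j' => j' < j) (assigned^~ k) i + E i j <= P].

Definition remaining (j k : nat) : nat :=
  u j - \sum_(k' < K | k' < k) copies j k'.

Definition class_load (i j k : nat) : nat :=
  load predT (assigned^~ k) i + load (fun j' => j < j') (copies^~ k) i.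

Hypothesis support_le : forall j, j < n -> #|col_support j| <= K.
Hypothesis u_fits : forall i j, i < m -> j < n -> u j * E i j <= P.
Hypothesis acceptedE : forall j, j < n -> accepted j = accepts j.
Hypothesis assignedE : forall j k, j < n -> k < K ->
  assigned j k = [&& 0 < accepted j, \sum_(k' < K | k' < k) assigned j k' == 0 &
                     class_fits j k].
(* [remaining j k - max_i (remaining j k - q_i)] is the minimum of
   [remaining j k] and the [q_i]. *)
Hypothesis copiesE : forall j k, j < n -> k < K ->
  copies j k = (flag j && ~~ big j) *
    (remaining j k - \max_(i in col_support j)
                       (remaining j k - (P - class_load i j k) %/ E i j)).

Lemma accepted_gt0P j : j < n -> 0 < accepted j ->
  [/\ flag j, big j & forall i : 'I_m, 0 < E i j ->
     2 * load (fun j' => j < j') accepted i <= P].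
Proof.
move=> lt_j.
rewrite acceptedE // lt0b => /and3P[flag_j big_j /forall_inP all_i].
by split=> // i Eij; apply: all_i; rewrite in_col_support.
Qed.

Lemma big_u_le1 j : j < n -> big j -> u j <= 1.
Proof. by move=> lt_j /bigP[i lt_P]; have := u_fits (ltn_ord i) lt_j; nia. Qed.

Lemma assigned_le_accepted j k : j < n -> k < K -> assigned j k <= accepted j.
Proof.
by move=> lt_j lt_k; rewrite assignedE //; case: (accepted j) => [|a] //=;
  case: (_ && _).
Qed.

Lemma assigned_accepted j k : j < n -> k < K -> 0 < assigned j k ->
  0 < accepted j.
Proof. by move=> lt_j lt_k /leq_trans; apply; apply: assigned_le_accepted. Qed.

Lemma assigned_class_unique j k k' : j < n -> k < K -> k' < K ->
  0 < assigned j k -> 0 < assigned j k' -> k = k'.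
Proof.
move=> lt_j; wlog lt_kk : k k' / k < k' => [wl|] lt_k lt_k' Qk Qk'.
  by case: (ltngtP k k') => // lt_kk; [apply: wl | apply/esym/wl].
move: Qk'; rewrite assignedE // lt0b => /and3P[_ /eqP sum0 _].
have := leq_sum_term (p := fun k1 : 'I_K => k1 < k') (fun k1 => assigned j k1)
  (j := Ordinal lt_k) lt_kk.
by rewrite sum0 leqNgt Qk.
Qed.

Lemma assigned_load_prefix t k i : k < K -> i < m -> t <= n ->
  load (fun j => j < t) (assigned^~ k) i <= P.
Proof.
move=> lt_k lt_i; elim: t => [|t IH] lt_t; first by rewrite /row_load big_pred0.
rewrite /row_load (sum_ltnS (fun j => assigned j k * E i j)) //.
have [->|assigned_gt0] := posnP (assigned t k).
  by rewrite mul0n addn0 IH // ltnW.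
move: assigned_gt0; rewrite assignedE // lt0b => t_k; rewrite t_k mul1n.
by case/and3P: t_k => _ _ /forallP/(_ (Ordinal lt_i)).
Qed.

Lemma assigned_load k i : k < K -> i < m -> load predT (assigned^~ k) i <= P.
Proof. by move=> lt_k lt_i; rewrite -row_load_all assigned_load_prefix. Qed.

(* Acceptance runs through the columns backwards. *)
Definition last_accepted (i : nat) : nat :=
  find (fun l => (0 < accepted l) && (0 < E i l)) (iota 0 n).

Lemma last_acceptedP i j : j < n -> 0 < accepted j -> 0 < E i j ->
  [/\ last_accepted i <= j, 0 < accepted (last_accepted i),
      0 < E i (last_accepted i) &
      forall l, l < last_accepted i -> 0 < accepted l -> E i l = 0].
Proof.
move=> lt_j acc_j Eij; pose p l := (0 < accepted l) && (0 < E i l).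
have has_p : has p (iota 0 n)
  by apply/hasP; exists j; rewrite ?mem_iota // /p acc_j.
have lt_n : last_accepted i < n by rewrite -[n](size_iota 0) -has_find.
have /andP[acc_l E_l] : p (last_accepted i).
  by have := nth_find 0 has_p; rewrite nth_iota.
have before l : l < last_accepted i -> ~~ p l.
  move=> lt_l; have := before_find 0 lt_l.
  rewrite nth_iota ?(ltn_trans lt_l) //.
  by rewrite add0n -/(p l) => ->.
split=> //.
  by rewrite leqNgt; apply/negP => /before; rewrite /p acc_j Eij.
by move=> l /before pl acc; move: pl; rewrite /p acc -eqn0Ngt => /eqP.
Qed.

Lemma row_blockedP j k (i : 'I_m) : j < n -> k < K -> 0 < accepted j ->
  P < load (fun j' => j' < j) (assigned^~ k) i + E i j ->
  [/\ 0 < E i j, last_accepted i < j & 0 < assigned (last_accepted i) k].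
Proof.
move=> lt_j lt_k acc_j lt_P; have [flag_j big_j _] := accepted_gt0P lt_j acc_j.
have le_E : E i j <= P.
  by have := u_fits (ltn_ord i) lt_j; have := flagged_u_gt0 flag_j; nia.
have Eij : 0 < E i j.
  by have := assigned_load_prefix lt_k (ltn_ord i) (ltnW lt_j); lia.
have [le_l acc_l El before] := last_acceptedP lt_j acc_j Eij.
have lt_l : last_accepted i < j.
  rewrite ltn_neqAle le_l andbT; apply: contraTneq lt_P => eq_l.
  rewrite -leqNgt /row_load big1 // => j' lt_j'.
  have [->//|assigned_j'] := posnP (assigned j' k).
  by rewrite before ?muln0 ?eq_l // (assigned_accepted _ lt_k).
split=> //; have lt_ln := ltn_trans lt_l lt_j; rewrite lt0n.
apply: contraL lt_P => /eqP not_l; rewrite -leqNgt.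
have [_ _ /(_ i El)] := accepted_gt0P lt_ln acc_l; apply: leq_trans.
have E_le : E i j <= load (fun j' => last_accepted i < j') accepted i.
  have := leq_row_load_term E (p := fun l => last_accepted i < l)
    accepted i lt_j lt_l.
  by apply: leq_trans; rewrite leq_pmull.
rewrite mul2n -addnn; apply: leq_add E_le.
apply: leq_row_load => j' lt_j' lt_j'j assigned_j' Ej'.
have acc_j' := assigned_accepted lt_j' lt_k assigned_j'.
rewrite assigned_le_accepted // ltn_neqAle; split=> //; apply/andP; split.
  by apply: contraTneq assigned_j' => <-; rewrite not_l.
by rewrite leqNgt; apply: contraTN Ej' => /before/(_ acc_j')->.
Qed.

(* Each class blocks [j] through a different row, and none of these rows is
   the one where [j] is big, in which nothing was accepted after [j]. *)
Lemma class_fits_exists j : j < n -> 0 < accepted j ->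
  exists k : 'I_K, class_fits j k.
Proof.
move=> lt_j acc_j; apply/existsP; apply: contraT => /existsPn no_k.
have /fin_all_exists[f block_f] (k : 'I_K) : exists i : 'I_m,
    [/\ 0 < E i j, last_accepted i < j & 0 < assigned (last_accepted i) k].
  have /forallPn[i] := no_k k; rewrite -ltnNge => lt_P.
  by exists i; apply: row_blockedP.
have [flag_j /bigP[h lt_P] _] := accepted_gt0P lt_j acc_j.
have Ehj : 0 < E h j by lia.
have f_inj : injective f.
  move=> k k' eq_f; apply: val_inj.
  have [_ lt_l assigned_k] := block_f k; have [_ _ assigned_k'] := block_f k'.
  rewrite -eq_f in assigned_k'.
  apply: assigned_class_unique assigned_k assigned_k' => //.
  exact: ltn_trans lt_l lt_j.
have h_f : h \notin f @: 'I_K.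
  apply/imsetP => -[k _ eq_h]; have [_] := block_f k; rewrite -eq_h => lt_l _.
  have [_ acc_l El _] := last_acceptedP lt_j acc_j Ehj.
  have [_ _ /(_ h El)] := accepted_gt0P (ltn_trans lt_l lt_j) acc_l.
  have := leq_row_load_term E (p := fun l => last_accepted h < l)
    accepted h lt_j lt_l.
  by nia.
have : #|h |: f @: 'I_K| <= #|col_support j|.
  apply: subset_leq_card; apply/subsetP => i; rewrite in_col_support.
  by case/setU1P=> [->//|/imsetP[k _ ->]]; have [] := block_f k.
rewrite cardsU1 h_f card_imset // card_ord => /leq_trans/(_ (support_le lt_j)).
by rewrite add1n ltnn.
Qed.

Lemma sum_assigned j : j < n -> \sum_(k < K) assigned j k = accepted j.
Proof.
move=> lt_j; have [acc0|acc_j] := posnP (accepted j).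
  by rewrite acc0 big1 // => k _; rewrite assignedE // acc0.
have acc1 : accepted j = 1 by move: acc_j; rewrite acceptedE //; case: accepts.
have [k lt_k|k0 [_ assigned1 assigned0]] :=
  @first_fit K (class_fits j) (assigned j) _ (class_fits_exists lt_j acc_j).
  by rewrite assignedE // acc_j /= andbC.
by rewrite (bigD1 k0) //= assigned1 acc1 big1.
Qed.

Lemma copies_le_remaining j k : j < n -> k < K -> copies j k <= remaining j k.
Proof.
move=> lt_j lt_k; rewrite copiesE //; case: (_ && _); rewrite ?mul0n // mul1n.
exact: leq_subr.
Qed.

Lemma copies_small j k : j < n -> k < K -> 0 < copies j k -> flag j /\ ~~ big j.
Proof.
by move=> lt_j lt_k; rewrite copiesE // muln_gt0 lt0b => /andP[/andP[]].
Qed.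

Lemma copies_fit i j k : i < m -> j < n -> k < K ->
  copies j k * E i j <= P - class_load i j k.
Proof.
move=> lt_i lt_j lt_k; have [->|Eij] := posnP (E i j); first by rewrite muln0.
rewrite -leq_divRL // copiesE //; case: (_ && _); rewrite ?mul0n // mul1n.
have i_j : Ordinal lt_i \in col_support j by rewrite in_col_support.
rewrite leq_subCl; exact: (leq_bigmax_cond
  (F := fun i : 'I_m => remaining j k - (P - class_load i j k) %/ E i j) _ i_j).
Qed.

Lemma copies_maximal j k : j < n -> k < K -> flag j -> ~~ big j ->
  copies j k < remaining j k ->
  exists2 i : 'I_m, 0 < E i j & P < class_load i j k + (copies j k).+1 * E i j.
Proof.
move=> lt_j lt_k flag_j small_j lt_copies; apply/exists_inP; apply: contraT.
move/exists_inPn => no_i; have := copiesE lt_j lt_k.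
rewrite flag_j small_j mul1n.
set r := remaining j k in lt_copies *; set M := \max_(i in _) _.
suff : M <= r - (copies j k).+1 by lia.
apply/bigmax_leqP => i; rewrite in_col_support => Eij.
by rewrite leq_sub2l // leq_divRL //; have := no_i i Eij; lia.
Qed.

Lemma sum_copies_prefix j t : j < n -> t <= K ->
  \sum_(k < K | k < t) copies j k <= u j.
Proof.
move=> lt_j; elim: t => [|t IH] lt_t; first by rewrite big_pred0.
rewrite (sum_ltnS (fun k => copies j k)) //.
have := copies_le_remaining lt_j lt_t; have := IH (ltnW lt_t).
by rewrite /remaining; lia.
Qed.

Lemma sum_copies j : j < n -> \sum_(k < K) copies j k <= u j.
Proof.
move=> lt_j; have := sum_copies_prefix lt_j (leqnn K).
by rewrite (sum_ltn_ord K (fun k => copies j k)).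
Qed.

Lemma copies_lt_remaining j k : j < n -> k < K ->
  \sum_(k < K) copies j k < u j ->
  copies j k < remaining j k.
Proof.
move=> lt_j lt_k lt_u; rewrite /remaining ltn_subRL.
rewrite -(sum_ltnS (fun k => copies j k)) //; apply: leq_ltn_trans lt_u.
exact: leq_sum_sub.
Qed.

Definition solution (k j : nat) : nat := assigned j k + copies j k.
Definition total (j : nat) : nat := \sum_(k < K) solution k j.

Lemma solution_le_u k j : k < K -> j < n -> solution k j <= u j.
Proof.
move=> lt_k lt_j; rewrite /solution; have [->|copies_gt0] := posnP (copies j k).
  rewrite addn0; have [->//|assigned_gt0] := posnP (assigned j k).
  have acc_j := assigned_accepted lt_j lt_k assigned_gt0.
  have [/flagged_u_gt0 u_gt0 _ _] := accepted_gt0P lt_j acc_j.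
  by apply: leq_trans u_gt0; rewrite assignedE //; case: (_ && _).
have [_ small_j] := copies_small lt_j lt_k copies_gt0.
have [->|] := posnP (assigned j k).
  by apply: leq_trans (copies_le_remaining lt_j lt_k) _; apply: leq_subr.
move/(assigned_accepted lt_j lt_k)/(accepted_gt0P lt_j) => -[_ big_j _].
by rewrite big_j in small_j.
Qed.

Lemma solution_flagged k j : k < K -> j < n -> 0 < solution k j -> flag j.
Proof.
move=> lt_k lt_j; rewrite /solution addn_gt0 => /orP[|].
  by move/(assigned_accepted lt_j lt_k)/(accepted_gt0P lt_j) => -[].
by case/(copies_small lt_j lt_k).
Qed.

Lemma total_flagged j : j < n -> 0 < total j -> flag j.
Proof.
move=> lt_j; apply: contraTT => no_flag; rewrite -eqn0Ngt /total big1 // => k _.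
by apply/eqP; rewrite eqn0Ngt; apply: contra no_flag; apply: solution_flagged.
Qed.

Lemma total_big j : j < n -> big j -> total j = accepted j.
Proof.
move=> lt_j big_j; rewrite /total /solution big_split /= sum_assigned //.
rewrite big1 ?addn0 // => k _; apply/eqP; rewrite eqn0Ngt.
by apply/negP => /(copies_small lt_j (ltn_ord k))[_ /negP].
Qed.

Lemma total_small j : j < n -> ~~ big j -> total j = \sum_(k < K) copies j k.
Proof.
move=> lt_j small_j; rewrite /total /solution big_split /= sum_assigned //.
by rewrite acceptedE // /accepts (negPf small_j) andbF.
Qed.

Lemma solution_load k i : k < K -> i < m -> load predT (solution k) i <= P.
Proof.
move=> lt_k lt_i; rewrite row_loadD.
suff fits t t' : t + t' = n ->
    load predT (assigned^~ k) i + load (fun j => t <= j) (copies^~ k) i <= P.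
  exact: (fits 0 n).
elim: t' t => [|t' IH] t def_n.
  rewrite addn0 in def_n; rewrite [X in _ + X]/row_load big_pred0 => [|j].
    by rewrite addn0 assigned_load.
  by rewrite def_n leqNgt ltn_ord.
have lt_t : t < n by rewrite -def_n addnS ltnS leq_addr.
rewrite {2}/row_load (sum_leq_ltn (fun j => copies j k * E i j)) //.
rewrite -addSnnS in def_n; have := IH _ def_n.
by have := copies_fit lt_i lt_t lt_k; rewrite /class_load /row_load; lia.
Qed.

Hypothesis P_gt0 : 0 < P.
Hypothesis K_gt0 : 0 < K.
Local Notation later := (later_value m n K P E u).
Local Notation after j := (fun j' => time j < time j').

Definition quota (j : nat) : nat := P * K * (if big j then 2 else u j).

Lemma leq_sum_col_support (j : nat) (F : 'I_m -> nat) (i : 'I_m) :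
  0 < E i j -> F i <= \sum_(i' in col_support j) F i'.
Proof.
by rewrite -[0 < _](in_col_support (m := m));
  apply: (leq_sum_term (p := mem (col_support j))).
Qed.

Lemma row_load_total p i : load p total i = \sum_(k < K) load p (solution k) i.
Proof.
by rewrite exchange_big /=; apply: eq_bigr => j _; rewrite big_distrl.
Qed.

Lemma quota_le_big j : j < n -> flag j -> big j -> quota j <= 2 * later j total.
Proof.
move=> lt_j flag_j big_j; rewrite later_valueE /quota /gain big_j total_big //.
have [acc0|acc_j] := posnP (accepted j); last first.
  by rewrite mulnDr; apply: leq_trans (leq_addr _ _); nia.
have := acceptedE lt_j; rewrite acc0 /accepts flag_j big_j /= => /esym/eqP.
rewrite eqb0 => /forall_inPn[i]; rewrite in_col_support -ltnNge => Eij lt_P.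
have load_le : load (fun j' => j < j') accepted i <= load (after j) total i.
  apply: leq_row_load => j' lt_j' lt_jj' acc_j' _.
  have [_ big_j' _] := accepted_gt0P lt_j' acc_j'.
  by rewrite /time_of big_j big_j' ltn_add2l total_big.
have := leq_sum_col_support (load (after j) total) Eij.
move: (\sum_(_ in _) _) => S le_S; rewrite muln0 add0n.
have : K * P <= K * (2 * S) by rewrite leq_mul2l; apply/orP; right; lia.
by lia.
Qed.

Lemma class_load_le i j k : j < n -> ~~ big j -> k < K ->
  class_load i j k <= load (after j) (solution k) i.
Proof.
move=> lt_j small_j lt_k; rewrite row_loadD.
apply: leq_add; apply: leq_row_load.
  move=> j' lt_j' _ assigned_j' _.
  have acc_j' := assigned_accepted lt_j' lt_k assigned_j'.
  have [_ big_j' _] := accepted_gt0P lt_j' acc_j'.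
  by rewrite /time_of big_j' (negPf small_j); split=> //; lia.
move=> j' lt_j' lt_jj' /(copies_small lt_j' lt_k)[_ small_j'] _.
by rewrite /time_of (negPf small_j') (negPf small_j).
Qed.

(* A class that could not take all the remaining copies of [j] is more than
   half full in some row of [j], counting the copies it took. *)
Lemma class_share_small j k : j < n -> k < K -> flag j -> ~~ big j ->
  \sum_(k < K) copies j k < u j ->
  P * u j <=
  2 * (P * K * copies j k +
       u j * \sum_(i in col_support j) load (after j) (solution k) i).
Proof.
move=> lt_j lt_k flag_j small_j lt_u.
have lt_copies := copies_lt_remaining lt_j lt_k lt_u.
have [i Eij lt_P] := copies_maximal lt_j lt_k flag_j small_j lt_copies.
have := leq_sum_col_support (load (after j) (solution k)) Eij.
have := class_load_le i lt_j small_j lt_k; rewrite /remaining in lt_copies.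
have uE := u_fits (ltn_ord i) lt_j; have EP := smallP i small_j.
move: (class_load i j k) lt_P (load _ _ _) (\sum_(_ in _) _) =>
  L lt_P L' S le_L le_S.
have [copies0|copies_gt0] := posnP (copies j k).
  have : P <= 2 * S by lia.
  by rewrite copies0; nia.
have le_uS : u j * L <= u j * S by rewrite leq_mul2l; lia.
have : u j * P <= u j * L + (copies j k).+1 * P by nia.
have : P * copies j k <= P * K * copies j k by nia.
have : 2 * P <= u j * P by nia.
nia.
Qed.

Lemma quota_le_small j : j < n -> flag j -> ~~ big j ->
  quota j <= 2 * later j total.
Proof.
move=> lt_j flag_j small_j.
rewrite later_valueE /quota /gain (negPf small_j) total_small //.
have := sum_copies lt_j; rewrite leq_eqVlt => /predU1P[->|lt_u].
  by rewrite mulnDr; apply: leq_trans (leq_addr _ _); nia.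
under eq_bigr do rewrite row_load_total.
rewrite exchange_big !big_distrr -big_split big_distrr /=.
have -> : P * K * u j = \sum_(k < K) P * u j
  by rewrite sum_nat_const card_ord; nia.
by apply: leq_sum => k _; apply: class_share_small.
Qed.

Lemma quota_le j : j < n -> flag j -> quota j <= 2 * later j total.
Proof.
move=> lt_j flag_j; case: (boolP (big j)); first exact: quota_le_big.
exact: quota_le_small.
Qed.

Section UpperBound.
Variables (y : nat -> nat) (kappa C : nat).
Hypothesis y_le_u : forall j, j < n -> y j <= u j.
Hypothesis y_load : forall i, i < m -> load predT y i <= P.
Hypothesis support_le_kappa : forall j, j < n -> #|col_support j| <= kappa.
Hypothesis C_small : 2 * (K + kappa) <= C * K.
Hypothesis C_big : 0 < kappa -> 2 * K <= C.

Let load_after_le j (i : 'I_m) : load (after j) y i <= P.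
Proof. by apply: leq_trans (y_load (ltn_ord i)); apply: leq_row_load. Qed.

(* If [y] uses the big column [j], then the load of the others in the row where
   [j] is big is less than [P / 2]. *)
Lemma later_le_big j : j < n -> big j ->
  P * K * y j + 2 * K * \sum_(i in col_support j) load (after j) y i <=
  2 * K * (P * K).
Proof.
move=> lt_j big_j; have [h lt_h] := bigP big_j; have Ehj : 0 < E h j by lia.
have le_KP : \sum_(i in col_support j) P <= K * P.
  by rewrite sum_nat_const leq_mul2r support_le ?orbT.
have y_le1 : y j <= 1 := leq_trans (y_le_u lt_j) (big_u_le1 lt_j big_j).
have [y0|y_gt0] := posnP (y j).
  rewrite y0 muln0 add0n leq_mul2l [P * K]mulnC; apply/orP; right.
  by apply: leq_trans le_KP; apply: leq_sum => i _; apply: load_after_le.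
have y1 : y j = 1 by lia.
have load_le (i : 'I_m) : load (after j) y i + E i j <= P.
  apply: leq_trans (y_load (ltn_ord i)).
  rewrite [leqRHS]/row_load (bigD1 (Ordinal lt_j)) //= y1 mul1n addnC leq_add2l.
  apply: leq_sum_sub => j' lt_t _; split=> //.
  by apply: contraTneq lt_t => ->; rewrite ltnn.
have : \sum_(i in col_support j) load (after j) y i +
    \sum_(i in col_support j) E i j <= K * P.
  by rewrite -big_split; apply: leq_trans le_KP; apply: leq_sum => i _;
    apply: load_le.
have := leq_sum_col_support (fun i => E i j) Ehj.
move: (\sum_(_ in _) _) (\sum_(_ in _) _) => S1 S2; rewrite y1; nia.
Qed.

Lemma later_le_small j : j < n ->
  P * K * y j + u j * \sum_(i in col_support j) load (after j) y i <=
  (K + kappa) * (P * u j).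
Proof.
move=> lt_j.
have le_sum : \sum_(i in col_support j) load (after j) y i <= kappa * P.
  apply: leq_trans (_ : \sum_(i in col_support j) P <= _).
    by apply: leq_sum => i _; apply: load_after_le.
  by rewrite sum_nat_const leq_mul2r support_le_kappa ?orbT.
have le_y : P * K * y j <= P * K * u j by rewrite leq_mul2l y_le_u ?orbT.
by apply: leq_trans (leq_add le_y (leq_mul (leqnn (u j)) le_sum)) _; lia.
Qed.

Lemma later_le_quota j : j < n -> 2 * later j y <= C * quota j.
Proof.
move=> lt_j; rewrite later_valueE /quota /gain.
case: ifPn => [big_j|small_j].
  have [h lt_h] := bigP big_j; have kappa_gt0 : 0 < kappa.
    apply: leq_trans (support_le_kappa lt_j); apply/card_gt0P; exists h.
    by rewrite in_col_support; lia.
  have := leq_mul (C_big kappa_gt0) (leqnn (P * K)).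
  by have := later_le_big lt_j big_j; set T := _ + _; lia.
have := later_le_small lt_j; have := leq_mul C_small (leqnn (P * u j)).
by set T := _ + _; lia.
Qed.

Lemma total_approx : \sum_(j < n) c j * y j <= C * \sum_(j < n) c j * total j.
Proof.
have PK_gt0 : 0 < P * K by rewrite muln_gt0 P_gt0.
have := @local_ratio n (P * K) (2 * n) time (charge m K P E u) (weight u c)
  total y C PK_gt0 (@time_of_inj m n P E) (@time_of_lt m n P E) total_flagged.
have -> : \sum_(j < n) weight u c j * y j = \sum_(j < n) c j * y j.
  apply: eq_bigr => j _; have := y_le_u (ltn_ord j); rewrite /weight.
  by case: (u j) => [|v]; rewrite ?muln1 // leqn0 => /eqP->; rewrite !muln0.
move=> ratio; apply: leq_trans (ratio _) _ => [j lt_j flag_j|].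
  have := later_le_quota lt_j; have := quota_le lt_j flag_j.
  by rewrite /later_value; nia.
rewrite leq_mul2l; apply/orP; right; apply: leq_sum => j _.
rewrite leq_mul2r /weight.
by case: (0 < u j); rewrite ?muln1 ?muln0 ?leqnn ?orbT.
Qed.

End UpperBound.

End Selection.

(** * The program *)

Declare Scope expr_scope.
Delimit Scope expr_scope with E.
Bind Scope expr_scope with expr.
Notation "x + y" := (Binop OpAdd x y) : expr_scope.
Notation "x - y" := (Binop OpSub x y) : expr_scope.
Notation "x * y" := (Binop OpMul x y) : expr_scope.
Notation "x / y" := (Binop OpDiv x y) : expr_scope.
Notation "a .[ e ]" := (Entry a e) : expr_scope.
Notation "'ESum' ( B ) e" :=
  (Bigop AggSum B e) (at level 36, e at level 36) : expr_scope.
Notation "'EProd' ( B ) e" :=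
  (Bigop AggProd B e) (at level 36, e at level 36) : expr_scope.
Notation "'EMax' ( B ) e" :=
  (Bigop AggMax B e) (at level 36, e at level 36) : expr_scope.

(* Matrices are stored row by row.  The body of the input is what follows the
   two numbers of the header, and the rationals in it are scaled by their common
   denominator.  Rounding runs backwards through the columns, so [tab_accepted]
   and [tab_copies] list them in reverse order. *)
Definition tab_header : nat := 0.
Definition tab_num_entries : nat := 1.
Definition tab_num_rats : nat := 2.
Definition tab_body_size : nat := 3.
Definition tab_body : nat := 4.
Definition tab_denom : nat := 5.
Definition tab_scaled : nat := 6.
Definition tab_capacity : nat := 7.
Definition tab_matrix : nat := 8.
Definition tab_col_max : nat := 9.
Definition tab_mult : nat := 10.
Definition tab_classes : nat := 11.
Definition tab_big : nat := 12.
Definition tab_num_pairs : nat := 13.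
Definition tab_charge : nat := 14.
Definition tab_num_residuals : nat := 15.
Definition tab_residual : nat := 16.
Definition tab_flag : nat := 17.
Definition tab_accepted : nat := 18.
Definition tab_num_shares : nat := 19.
Definition tab_assigned : nat := 20.
Definition tab_copies : nat := 21.
Definition tab_value : nat := 22.
Definition tab_best : nat := 23.
Definition tab_chosen : nat := 24.
Definition tab_output : nat := 25.

Definition num_rows : bound := Cell tab_header 0.
Definition num_cols : bound := Cell tab_header 1.
Definition num_classes : bound := Cell tab_classes 0.
Definition scalar : bound := Fixed 1.
Definition size_in (a : nat) : bound := Cell a 0.

Section Program.
Local Open Scope expr_scope.
Local Coercion Lit : nat >-> expr.
Local Notation "` v" := (Var v) (at level 0, format "` v") : expr_scope.

Definition e_pos (e : expr) : expr := 1 - (1 - e).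
Definition e_zero (e : expr) : expr := 1 - e.
Definition e_gt (e1 e2 : expr) : expr := e_pos (e1 - e2).
Definition e_eq (e1 e2 : expr) : expr := 1 - ((e1 - e2) + (e2 - e1)).
Definition e_min (e1 e2 : expr) : expr := e1 - (e1 - e2).
Definition e_mod (e1 e2 : expr) : expr := e1 - e1 / e2 * e2.

Definition e_rows : expr := tab_header.[0].
Definition e_cols : expr := tab_header.[1].
Definition e_classes : expr := tab_classes.[0].
Definition e_capacity : expr := tab_capacity.[0].
Definition e_matrix (i j : expr) : expr := tab_matrix.[i * e_cols + j].
Definition e_obj (j : expr) : expr :=
  tab_scaled.[tab_num_entries.[0] + e_rows + j].
Definition e_rhs (i : expr) : expr :=
  2 * tab_scaled.[tab_num_entries.[0] + i] + 1.
Definition e_rev (j : expr) : expr := e_cols - 1 - j.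
Definition e_time (j : expr) : expr := tab_big.[j] * e_cols + j.
Definition e_solution (j k : expr) : expr :=
  tab_assigned.[j * e_classes + k] + tab_copies.[e_rev j * e_classes + k].

Definition mult_expr : expr :=
  let ub := tab_body.[2 * tab_num_rats.[0] + `0] in
  let em := tab_col_max.[`0] in
  e_zero ub * (e_capacity / em) +
  e_pos ub *
  (e_zero em * (ub - 1) + e_pos em * e_min (ub - 1) (e_capacity / em)).

Definition charge_expr : expr :=
  let j := `0 / e_cols in
  (tab_big.[j] * (2 * e_classes) + e_zero tab_big.[j] * tab_mult.[j]) *
  ESum (num_rows) (e_pos (e_matrix `0 (`1 / e_cols)) *
                   e_matrix `0 (e_mod `1 e_cols)).

Definition residual_expr : expr :=
  let t := `0 / e_cols in
  let t' := `1 / e_cols - 1 in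
  e_zero t * (e_obj `0 * e_pos tab_mult.[`0]) +
  e_pos t *
  (e_capacity * e_classes * tab_residual.[`0 - e_cols] -
   ESum (num_cols) (e_eq (e_time `0) t' *
                    (tab_residual.[t' * e_cols + `0] *
                     tab_charge.[`0 * e_cols + e_mod `1 e_cols]))).

Definition accepted_expr : expr :=
  let j := e_rev `0 in
  tab_flag.[j] * tab_big.[j] *
  EProd (num_rows)
    (1 - e_pos (e_matrix `0 (e_rev `1)) *
         e_gt (2 * ESum (num_cols) (tab_accepted.[`0] * e_matrix `1 (e_rev `0)))
              e_capacity).

Definition assigned_expr : expr :=
  tab_accepted.[e_rev (`0 / e_classes)] *
  (1 - ESum (num_classes) tab_assigned.[`1 / e_classes * e_classes + `0]) *
  EProd (num_rows)
    (1 - (ESum (num_cols) (tab_assigned.[`0 * e_classes + e_mod `2 e_classes] *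
                           e_matrix `1 `0) +
          e_matrix `0 (`1 / e_classes) - e_capacity)).

(* Under [d] binders the current index of the table is variable [d]. *)
Definition e_remaining (d : nat) : expr :=
  tab_mult.[e_rev (Var d / e_classes)] -
  ESum (num_classes) tab_copies.[Var d.+1 / e_classes * e_classes + `0].

Definition e_class_load : expr :=
  ESum (num_cols) (tab_assigned.[`0 * e_classes + e_mod `2 e_classes] *
                   e_matrix `1 `0) +
  ESum (num_cols) (tab_copies.[`0 * e_classes + e_mod `2 e_classes] *
                   e_matrix `1 (e_rev `0)).

Definition copies_expr : expr :=
  let j := e_rev (`0 / e_classes) in
  tab_flag.[j] * e_zero tab_big.[j] *
  (e_remaining 0 -
   EMax (num_rows)
     (let e := e_matrix `0 (e_rev (`1 / e_classes)) in
      e_pos e * (e_remaining 1 - (e_capacity - e_class_load) / e))).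

Definition tables : seq stmt :=
  [:: Input (Fixed 2);
      Table scalar (e_rows * e_cols);
      Table scalar (tab_num_entries.[0] + e_rows + e_cols);
      Table scalar (2 * tab_num_rats.[0] + e_cols);
      Input (size_in tab_body_size);
      Table scalar (EProd (size_in tab_num_rats) tab_body.[2 * `0 + 1]);
      Table (size_in tab_num_rats)
        (tab_body.[2 * `0] * (tab_denom.[0] / tab_body.[2 * `0 + 1]));
      Table scalar (EProd (num_rows) e_rhs `0);
      Table (size_in tab_num_entries)
        (2 * tab_scaled.[`0] * (e_capacity / e_rhs (`0 / e_cols)));
      Table num_cols (EMax (num_rows) e_matrix `0 `1);
      Table num_cols mult_expr;
      Table scalar
        (Binop OpMax 1
           (EMax (num_cols) ESum (num_rows) e_pos (e_matrix `0 `1)));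
      Table num_cols (e_gt (2 * tab_col_max.[`0]) e_capacity);
      Table scalar (e_cols * e_cols);
      Table (size_in tab_num_pairs) charge_expr;
      Table scalar (2 * tab_num_pairs.[0]);
      Table (size_in tab_num_residuals) residual_expr;
      Table num_cols (e_pos tab_residual.[e_time `0 * e_cols + `0]);
      Table num_cols accepted_expr;
      Table scalar (e_cols * e_classes);
      Table (size_in tab_num_shares) assigned_expr;
      Table (size_in tab_num_shares) copies_expr;
      Table num_classes (ESum (num_cols) (e_obj `0 * e_solution `0 `1));
      Table scalar (EMax (num_classes) tab_value.[`0]);
      Table num_classes (e_zero (tab_best.[0] - tab_value.[`0]) *
                         (1 - ESum (num_classes) tab_chosen.[`0]));
      Table num_cols (ESum (num_classes) (tab_chosen.[`0] * e_solution `1 `0))].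

End Program.

Definition solver : program := compile tables num_cols.

Lemma tables_wf : all stmt_wf tables.
Proof. by vm_compute. Qed.

Lemma sub1_sub1 x : 1 - (1 - x) = (0 < x). Proof. by case: x. Qed.

Lemma sub1n x : 1 - x = (x == 0). Proof. by case: x. Qed.

Lemma sub1_dist x y : 1 - (x - y + (y - x)) = (x == y).
Proof. by case: eqP => [->|ne_xy]; lia. Qed.

Lemma sum_mask N (p : pred 'I_N) (F : 'I_N -> nat) :
  \sum_(i < N) p i * F i = \sum_(i < N | p i) F i.
Proof. by rewrite [RHS]big_mkcond; apply: eq_bigr => i _; rewrite mulnbl. Qed.

Lemma max_mask N (p : pred 'I_N) (F : 'I_N -> nat) :
  \max_(i < N) p i * F i = \max_(i < N | p i) F i.
Proof. by rewrite [RHS]big_mkcond; apply: eq_bigr => i _; rewrite mulnbl. Qed.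

Lemma prod_bool N (p : pred 'I_N) : \prod_(i < N) (p i : nat) = [forall i, p i].
Proof.
have [/forallP all_p|/forallPn[i /negPf p_i]] := boolP [forall i, p i].
  by rewrite big1 // => i _; rewrite all_p.
by rewrite (bigD1 i) //= p_i.
Qed.

Lemma card_col_support m E j : #|col_support m E j| = \sum_(i < m) (0 < E i j).
Proof.
by rewrite -sum1dep_card big_mkcond; apply: eq_bigr => i _; case: (0 < _).
Qed.

Lemma divn_pair i N j : j < N -> (i * N + j) %/ N = i.
Proof. by move=> lt_j; rewrite divnMDl ?divn_small ?addn0 //; case: N lt_j. Qed.

Lemma modn_pair i N j : j < N -> i * N + j - (i * N + j) %/ N * N = j.
Proof. by move=> lt_j; rewrite divn_pair // addKn. Qed.

Lemma ltn_pair i j M N : i < M -> j < N -> i * N + j < M * N.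
Proof.
by move=> lt_i lt_j; apply: leq_trans (_ : i.+1 * N <= _);
  rewrite ?leq_mul2r ?lt_i ?orbT // mulSn addnC ltn_add2r.
Qed.

Lemma sum_before_rev N j (z F : nat -> nat) : j < N ->
  \sum_(l < N) (l < N - 1 - j) * z l * F (N - 1 - l) =
  \sum_(l < N | j < l) z (N - 1 - l) * F l.
Proof.
move=> lt_j; rewrite (reindex_inj rev_ord_inj) [RHS]big_mkcond.
apply: eq_bigr => l _.
have lt_l := ltn_ord l; rewrite /= -[N - l.+1]/(N - (1 + l)) subnDA.
have -> : N - 1 - (N - 1 - l) = l by lia.
have -> : (N - 1 - l < N - 1 - j) = (j < l) by lia.
by rewrite -mulnA mulnbl.
Qed.

(* The product [C * maxn 1 kappa] is [2] for [kappa = 0], [4] for [kappa = 1]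
   and [2 * kappa ^ 2] otherwise. *)
Lemma approx_factor kappa k : kappa <= k -> exists C,
  [/\ 2 * (maxn 1 kappa + kappa) <= C * maxn 1 kappa,
      0 < kappa -> 2 * maxn 1 kappa <= C & C * maxn 1 kappa <= 2 * k ^ 2 + 2].
Proof.
case: kappa => [|[|kappa]] le_k; [exists 2 | exists 4 | exists (2 * kappa.+2)];
  by rewrite ?maxn0 ?maxnn ?(maxn_idPr _) // -mulnn; split; nia.
Qed.

Section Entries.
Variables (w : word) (M : memory).
Hypothesis M_run : run_of w tables M.
Local Notation m := (M tab_header 0).
Local Notation n := (M tab_header 1).
Local Notation mn := (M tab_num_entries 0).
Local Notation num_rats := (M tab_num_rats 0).
Local Notation K := (M tab_classes 0).
Local Notation P := (M tab_capacity 0).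
Local Notation E := (fun i j => M tab_matrix (i * n + j)).
Local Notation u := (M tab_mult).
Local Notation c := (fun j => M tab_scaled (mn + m + j)).
Local Notation rhs_row i := (2 * M tab_scaled (mn + i) + 1).
Local Notation accepted := (fun j => M tab_accepted (n - 1 - j)).
Local Notation assigned := (fun j k => M tab_assigned (j * K + k)).
Local Notation copies := (fun j k => M tab_copies ((n - 1 - j) * K + k)).
Local Notation sol := (solution assigned copies).

Lemma tab_headerE i : M tab_header i = if i < 2 then nth 0 w i else 0.
Proof. exact: (input_entry (a := tab_header) M_run i erefl isT). Qed.

Lemma tab_num_entriesE : mn = m * n.
Proof.
exact: (table_entry (a := tab_num_entries) M_run erefl isT (isT : 0 < 1)).
Qed.

Lemma tab_num_ratsE : num_rats = mn + m + n.
Proof.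
exact: (table_entry (a := tab_num_rats) M_run erefl isT (isT : 0 < 1)).
Qed.

Lemma tab_body_sizeE : M tab_body_size 0 = 2 * num_rats + n.
Proof.
exact: (table_entry (a := tab_body_size) M_run erefl isT (isT : 0 < 1)).
Qed.

Lemma tab_bodyE i :
  M tab_body i = if i < M tab_body_size 0 then nth 0 (drop 2 w) i else 0.
Proof. exact: (input_entry (a := tab_body) M_run i erefl isT). Qed.

Lemma tab_denomE : M tab_denom 0 = \prod_(i < num_rats) M tab_body (2 * i + 1).
Proof. exact: (table_entry (a := tab_denom) M_run erefl isT (isT : 0 < 1)). Qed.

Lemma tab_scaledE i : i < num_rats ->
  M tab_scaled i =
  M tab_body (2 * i) * (M tab_denom 0 %/ M tab_body (2 * i + 1)).
Proof. exact: (table_entry (a := tab_scaled) M_run erefl isT). Qed.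

Lemma tab_capacityE : P = \prod_(i < m) rhs_row i.
Proof.
exact: (table_entry (a := tab_capacity) M_run erefl isT (isT : 0 < 1)).
Qed.

Lemma tab_matrixE i : i < mn ->
  M tab_matrix i = 2 * M tab_scaled i * (P %/ rhs_row (i %/ n)).
Proof. exact: (table_entry (a := tab_matrix) M_run erefl isT). Qed.

Lemma tab_col_maxE j : j < n -> M tab_col_max j = col_max m E j.
Proof. exact: (table_entry (a := tab_col_max) M_run erefl isT). Qed.

Lemma tab_multE j : j < n ->
  let ub := M tab_body (2 * num_rats + j) in let em := M tab_col_max j in
  u j = (ub == 0) * (P %/ em) +
    (0 < ub) *
    ((em == 0) * (ub - 1) + (0 < em) * (ub - 1 - (ub - 1 - P %/ em))).
Proof.
move=> lt_j ub em; rewrite -!sub1_sub1 -!sub1n.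
exact: (table_entry (a := tab_mult) M_run erefl isT lt_j).
Qed.

Lemma tab_classesE : K = maxn 1 (\max_(j < n) #|col_support m E j|).
Proof.
rewrite (eq_bigr (fun j : 'I_n => \sum_(i < m) (1 - (1 - E i j)))) => [|j _].
  exact: (table_entry (a := tab_classes) M_run erefl isT (isT : 0 < 1)).
by rewrite card_col_support; apply: eq_bigr => i _; rewrite sub1_sub1.
Qed.

Lemma tab_bigE j : j < n -> M tab_big j = is_big m P E j.
Proof.
move=> lt_j; rewrite /is_big -subn_gt0 -sub1_sub1 -tab_col_maxE //.
exact: (table_entry (a := tab_big) M_run erefl isT lt_j).
Qed.

Lemma tab_num_pairsE : M tab_num_pairs 0 = n * n.
Proof.
exact: (table_entry (a := tab_num_pairs) M_run erefl isT (isT : 0 < 1)).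
Qed.

Lemma tab_chargeE j j' : j < n -> j' < n ->
  M tab_charge (j * n + j') = charge m K P E u j j'.
Proof.
move=> lt_j lt_j'; set x := j * n + j'.
have lt_x : x < M tab_num_pairs 0 by rewrite tab_num_pairsE ltn_pair.
have -> : M tab_charge x =
    (M tab_big (x %/ n) * (2 * K) + (1 - M tab_big (x %/ n)) * u (x %/ n)) *
    \sum_(i < m) (1 - (1 - E i (x %/ n))) * E i (x - x %/ n * n).
  exact: (table_entry (a := tab_charge) M_run erefl isT lt_x).
rewrite modn_pair // divn_pair // tab_bigE // /charge /gain; congr (_ * _).
  by case: (is_big _ _ _ _); rewrite ?mul1n ?mul0n ?addn0.
by rewrite -[RHS]sum_mask; apply: eq_bigr => i _;
  rewrite sub1_sub1 in_col_support.
Qed.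

Lemma tab_num_residualsE : M tab_num_residuals 0 = 2 * M tab_num_pairs 0.
Proof.
exact: (table_entry (a := tab_num_residuals) M_run erefl isT (isT : 0 < 1)).
Qed.

Lemma tab_residualE x : x < M tab_num_residuals 0 ->
  M tab_residual x =
  (1 - x %/ n) * (c x * (1 - (1 - u x))) +
  (1 - (1 - x %/ n)) *
  (P * K * ((x - n < x) * M tab_residual (x - n)) -
   let t := x %/ n - 1 in
   \sum_(j < n)
     (1 - ((M tab_big j * n + j - t) + (t - (M tab_big j * n + j)))) *
     ((t * n + j < x) * M tab_residual (t * n + j) *
      M tab_charge (j * n + (x - x %/ n * n)))).
Proof. exact: (table_entry (a := tab_residual) M_run erefl isT). Qed.

Lemma tab_residual_residual t j : t < 2 * n -> j < n ->
  M tab_residual (t * n + j) =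
  residual n (P * K) (time_of m n P E) (charge m K P E u) (weight u c) t j.
Proof.
elim: t j => [|t IH] j lt_t lt_j;
  (rewrite tab_residualE; last by
     rewrite tab_num_residualsE tab_num_pairsE mulnA ltn_pair).
  by rewrite mul0n add0n divn_small // sub1_sub1 addn0 mul1n.
rewrite /= modn_pair // divn_pair // subn1 residualS add0n mul1n.
have -> : t.+1 * n + j - n = t * n + j by rewrite mulSn; lia.
rewrite IH //; last by lia.
have -> : t * n + j < t.+1 * n + j by rewrite mulSn; lia.
rewrite mul1n -sum_mask; congr (_ - _); apply: eq_bigr => l _.
have lt_l := ltn_ord l; rewrite tab_bigE // sub1_dist tab_chargeE // IH //;
  last by lia.
have -> : t * n + l < t.+1 * n + j by rewrite mulSn; lia.
by rewrite mul1n.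
Qed.

Lemma tab_flagE j : j < n -> M tab_flag j = flagged m n K P E u c j.
Proof.
move=> lt_j.
have -> : M tab_flag j =
    1 - (1 - M tab_residual ((M tab_big j * n + j) * n + j)).
  exact: (table_entry (a := tab_flag) M_run erefl isT lt_j).
rewrite tab_bigE // sub1_sub1 tab_residual_residual //; exact: time_of_lt lt_j.
Qed.

Lemma tab_acceptedE j : j < n -> accepted j = accepts m n K P E u c accepted j.
Proof.
move=> lt_j; set s := n - 1 - j; have lt_s : s < n by lia.
have eq_j : n - 1 - s = j by lia.
have -> : M tab_accepted s = M tab_flag (n - 1 - s) * M tab_big (n - 1 - s) *
    \prod_(i < m) (1 - (1 - (1 - E i (n - 1 - s))) *
      (1 - (1 -
        (2 * (\sum_(l < n) (l < s) * M tab_accepted l * E i (n - 1 - l)) -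
          P)))).
  exact: (table_entry (a := tab_accepted) M_run erefl isT lt_s).
rewrite eq_j tab_flagE // tab_bigE // !mulnb /accepts andbA.
under eq_bigr => i _.
  rewrite !sub1_sub1 mulnb sub1n eqb0 negb_and -implybE subn_gt0 -leqNgt.
  rewrite (sum_before_rev (M tab_accepted) (E i) lt_j).
  over.
rewrite prod_bool mulnb; congr (nat_of_bool (_ && _)).
by apply: eq_forallb => i; rewrite in_col_support.
Qed.

Lemma tab_num_sharesE : M tab_num_shares 0 = n * K.
Proof.
exact: (table_entry (a := tab_num_shares) M_run erefl isT (isT : 0 < 1)).
Qed.

Lemma tab_assignedE j k : j < n -> k < K ->
  assigned j k = [&& 0 < accepted j, \sum_(k' < K | k' < k) assigned j k' == 0 &
                     class_fits m n P E assigned j k].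
Proof.
move=> lt_j lt_k; set x := j * K + k.
have lt_x : x < M tab_num_shares 0 by rewrite tab_num_sharesE ltn_pair.
have -> : M tab_assigned x = accepted (x %/ K) *
    (1 - \sum_(k' < K)
       (x %/ K * K + k' < x) * M tab_assigned (x %/ K * K + k')) *
    \prod_(i < m) (1 - (\sum_(l < n)
       ((l * K + (x - x %/ K * K) < x) *
        M tab_assigned (l * K + (x - x %/ K * K))) *
       E i l + E i (x %/ K) - P)).
  exact: (table_entry (a := tab_assigned) M_run erefl isT lt_x).
rewrite modn_pair // divn_pair // sub1n tab_acceptedE // lt0b.
rewrite mulnb; under [\prod_(_ < _) _]eq_bigr => i _.
  rewrite sub1n subn_eq0; under eq_bigr do
    rewrite ltn_add2r ltn_pmul2r ?(leq_ltn_trans _ lt_k) // -mulnA.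
  rewrite sum_mask; over.
rewrite prod_bool mulnb -andbA.
under [\sum_(_ < _) _]eq_bigr do rewrite ltn_add2l.
by rewrite sum_mask.
Qed.

Lemma tab_copiesE j k : j < n -> k < K ->
  copies j k = (flagged m n K P E u c j && ~~ is_big m P E j) *
    (remaining K u copies j k - \max_(i in col_support m E j)
       (remaining K u copies j k -
        (P - class_load n E assigned copies i j k) %/ E i j)).
Proof.
move=> lt_j lt_k; set s := n - 1 - j; set x := s * K + k.
have lt_s : s < n by lia.
have eq_j : n - 1 - s = j by lia.
have lt_x : x < M tab_num_shares 0 by rewrite tab_num_sharesE ltn_pair.
have -> : M tab_copies x =
    M tab_flag (n - 1 - x %/ K) * (1 - M tab_big (n - 1 - x %/ K)) *
    (u (n - 1 - x %/ K) -
     \sum_(k' < K) (x %/ K * K + k' < x) * M tab_copies (x %/ K * K + k') -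
     \max_(i < m) (1 - (1 - E i (n - 1 - x %/ K))) *
       (u (n - 1 - x %/ K) -
        \sum_(k' < K) (x %/ K * K + k' < x) * M tab_copies (x %/ K * K + k') -
        (P - (\sum_(l < n) M tab_assigned (l * K + (x - x %/ K * K)) * E i l +
              \sum_(l < n) (l * K + (x - x %/ K * K) < x) *
                M tab_copies (l * K + (x - x %/ K * K)) * E i (n - 1 - l)))
        %/ E i (n - 1 - x %/ K))).
  exact: (table_entry (a := tab_copies) M_run erefl isT lt_x).
rewrite modn_pair // divn_pair // eq_j tab_flagE // tab_bigE // sub1n eqb0.
rewrite mulnb.
under [\sum_(_ < K) _]eq_bigr do rewrite ltn_add2l.
rewrite sum_mask -/(remaining K u copies j k); congr (_ * (_ - _)).
rewrite -[RHS]max_mask; apply: eq_bigr => i _; rewrite sub1_sub1 in_col_support.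
congr (_ * (_ - (_ - (_ + _)) %/ _)).
under eq_bigr do rewrite ltn_add2r ltn_pmul2r ?(leq_ltn_trans _ lt_k) //.
exact: (sum_before_rev (fun l => M tab_copies (l * K + k)) (E i) lt_j).
Qed.

Lemma tab_valueE k : k < K -> M tab_value k = \sum_(j < n) c j * sol k j.
Proof. exact: (table_entry (a := tab_value) M_run erefl isT). Qed.

Lemma tab_bestE : M tab_best 0 = \max_(k < K) M tab_value k.
Proof. exact: (table_entry (a := tab_best) M_run erefl isT (isT : 0 < 1)). Qed.

Lemma tab_chosenE k : k < K ->
  M tab_chosen k = (M tab_best 0 <= M tab_value k) &&
                   (\sum_(k' < K | k' < k) M tab_chosen k' == 0) :> nat.
Proof.
move=> lt_k; have -> : M tab_chosen k = (1 - (M tab_best 0 - M tab_value k)) *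
    (1 - \sum_(k' < K) (k' < k) * M tab_chosen k').
  exact: (table_entry (a := tab_chosen) M_run erefl isT lt_k).
by rewrite !sub1n mulnb subn_eq0 sum_mask.
Qed.

Lemma tab_outputE j : j < n ->
  M tab_output j = \sum_(k < K) M tab_chosen k * sol k j.
Proof. exact: (table_entry (a := tab_output) M_run erefl isT). Qed.

Lemma classes_gt0 : 0 < K.
Proof. by rewrite tab_classesE leq_max. Qed.

Lemma capacity_gt0 : 0 < P.
Proof. by rewrite tab_capacityE prodn_gt0 // => i; rewrite addn1. Qed.

Lemma rhs_dvd_capacity i : i < m -> rhs_row i %| P.
Proof.
by move=> lt_i; rewrite tab_capacityE (bigD1 (Ordinal lt_i)) //=;
  apply: dvdn_mulr.
Qed.

Lemma row_scale_gt0 i : i < m -> 0 < P %/ rhs_row i.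
Proof.
move=> lt_i; rewrite divn_gt0 ?addn1 // -addn1 dvdn_leq ?capacity_gt0 //.
exact: rhs_dvd_capacity.
Qed.

Lemma matrix_le_col_max i j : i < m -> j < n -> E i j <= M tab_col_max j.
Proof.
move=> lt_i lt_j; rewrite tab_col_maxE // /col_max.
exact: (leq_bigmax (F := fun i : 'I_m => E i j) (Ordinal lt_i)).
Qed.

Lemma mult_le_div j : j < n -> 0 < M tab_col_max j ->
  u j <= P %/ M tab_col_max j.
Proof.
move=> lt_j em_gt0; rewrite tab_multE // em_gt0 (gtn_eqF em_gt0).
case: (M tab_body _) => [|d]; rewrite /= ?mul0n ?mul1n ?add0n ?addn0 //.
by rewrite leq_subCl.
Qed.

Lemma mult_fits i j : i < m -> j < n -> u j * E i j <= P.
Proof.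
move=> lt_i lt_j; have le_E := matrix_le_col_max lt_i lt_j.
have [->|E_gt0] := posnP (E i j); first by rewrite muln0.
have em_gt0 : 0 < M tab_col_max j by apply: leq_trans le_E.
exact: leq_trans (leq_mul (mult_le_div lt_j em_gt0) le_E) (leq_divM _ _).
Qed.

Lemma card_col_support_le j : j < n ->
  #|col_support m E j| <= \max_(j < n) #|col_support m E j|.
Proof.
move=> lt_j.
exact: (leq_bigmax (F := fun j : 'I_n => #|col_support m E j|) (Ordinal lt_j)).
Qed.

Lemma card_col_support_classes j : j < n -> #|col_support m E j| <= K.
Proof.
by move=> lt_j; rewrite tab_classesE leq_max card_col_support_le ?orbT.
Qed.

Lemma output_best_class : exists k0 : 'I_K,
  (forall j, j < n -> M tab_output j = sol k0 j) /\
  forall k : 'I_K, M tab_value k <= M tab_value k0.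
Proof.
have le_best (k : 'I_K) : M tab_value k <= M tab_best 0.
  by rewrite tab_bestE;
    apply: (leq_bigmax (F := fun k : 'I_K => M tab_value k)).
have [|k0 [best_k0 chosen1 chosen0]] := first_fit tab_chosenE.
  have [|k max_k] := @bigop.eq_bigmax _ (fun k : 'I_K => M tab_value k).
    by rewrite card_ord classes_gt0.
  by exists k; rewrite tab_bestE max_k.
exists k0; split=> [j lt_j|k]; last exact: leq_trans (le_best k) best_k0.
rewrite tab_outputE // (bigD1 k0) //= chosen1 mul1n big1 ?addn0 // => k neq_k.
by rewrite chosen0.
Qed.

Lemma output_load i : i < m -> row_load n E predT (M tab_output) i <= P.
Proof.
move=> lt_i; have [k0 [out_k0 _]] := output_best_class.
have := solution_load tab_assignedE tab_copiesE (ltn_ord k0) lt_i.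
by apply: leq_trans; apply: leq_row_load => j lt_j _ _ _; rewrite out_k0.
Qed.

Lemma output_le_mult j : j < n -> M tab_output j <= u j.
Proof.
move=> lt_j; have [k0 [out_k0 _]] := output_best_class; rewrite out_k0 //.
exact: (solution_le_u tab_acceptedE tab_assignedE tab_copiesE
  (ltn_ord k0) lt_j).
Qed.

Lemma output_approx (y : nat -> nat) k :
  (forall j, j < n -> y j <= u j) ->
  (forall i, i < m -> row_load n E predT y i <= P) ->
  (forall j, j < n -> #|col_support m E j| <= k) ->
  \sum_(j < n) c j * y j <= (2 * k ^ 2 + 2) * \sum_(j < n) c j * M tab_output j.
Proof.
move=> y_le_u y_load support_le_k.
have [k0 [out_k0 best_k0]] := output_best_class.
have le_k : \max_(j < n) #|col_support m E j| <= k.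
  by apply/bigmax_leqP => j _; apply: support_le_k.
have [C [C_small C_big CK_le]] := approx_factor le_k.
rewrite -tab_classesE in C_small C_big CK_le.
have := total_approx card_col_support_classes mult_fits
  tab_acceptedE tab_assignedE tab_copiesE capacity_gt0 classes_gt0
  y_le_u y_load card_col_support_le C_small C_big.
move=> /leq_trans; apply; apply: leq_trans (leq_mul CK_le (leqnn _)).
rewrite -mulnA leq_mul2l; apply/orP; right.
have -> : \sum_(j < n) c j * M tab_output j = M tab_value k0.
  by rewrite tab_valueE //; apply: eq_bigr => j _; rewrite out_k0.
rewrite /total; under eq_bigr => j _ do rewrite big_distrr /=.
rewrite exchange_big /=.
apply: leq_trans (_ : \sum_(k < K) M tab_value k0 <= _).
  by apply: leq_sum => k' _; rewrite -tab_valueE.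
by rewrite sum_nat_const card_ord.
Qed.

End Entries.

(** * Correctness on encoded programs *)

Import Order.TTheory GRing.Theory Num.Theory.

Lemma size_flatten_rat (s : seq rat) :
  size (flatten (map encode_rat s)) = 2 * size s.
Proof. by elim: s => //= q s ->; lia. Qed.

Lemma nth_flatten_rat (s : seq rat) x : x < size s ->
  nth 0 (flatten (map encode_rat s)) (2 * x) = `|numq (nth 0%R s x)|%N /\
  nth 0 (flatten (map encode_rat s)) (2 * x + 1) = `|denq (nth 0%R s x)|%N.
Proof.
elim: s x => // q s IH [|x] lt_x //.
have -> : 2 * x.+1 = (2 * x).+2 by lia.
exact: IH.
Qed.

Lemma nth_allpairs (S T U : Type) (x0 : S) (y0 : T) (z0 : U)
    (f : S -> T -> U) s t i j :
  i < size s -> j < size t ->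
  nth z0 [seq f x y | x <- s, y <- t] (i * size t + j) =
  f (nth x0 s i) (nth y0 t j).
Proof.
move=> + lt_j; elim: s i => // x s IH [|i] /= lt_i; rewrite nth_cat size_map.
  by rewrite mul0n add0n lt_j (nth_map y0).
by rewrite mulSn -addnA ltnNge leq_addr addKn IH.
Qed.

Section Encoding.
Variable I : pip.
Local Notation rows := (nrows I).
Local Notation cols := (ncols I).

Definition pip_rats : seq rat :=
  [seq cmat I i j | i <- enum 'I_rows, j <- enum 'I_cols] ++
  [seq rhs I i 0%R | i <- enum 'I_rows] ++
  [seq obj I 0%R j | j <- enum 'I_cols].

Definition pip_body : word :=
  flatten (map encode_rat pip_rats) ++
  [seq encode_ubound (ubound I j) | j <- enum 'I_cols].

Lemma encode_pipE : encode_pip I = [:: rows; cols] ++ pip_body.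
Proof.
rewrite /encode_pip /pip_body /pip_rats !map_cat !flatten_cat -!catA.
by rewrite map_allpairs -!map_comp.
Qed.

Lemma size_pip_rats : size pip_rats = rows * cols + rows + cols.
Proof.
rewrite /pip_rats !size_cat size_allpairs [size (map _ (enum 'I_rows))]size_map.
by rewrite [size (map _ _)]size_map !size_enum_ord addnA.
Qed.

Lemma nth_cmat (i : 'I_rows) (j : 'I_cols) :
  nth 0%R pip_rats (i * cols + j) = cmat I i j.
Proof.
rewrite /pip_rats nth_cat size_allpairs !size_enum_ord ltn_pair //.
have := nth_allpairs i j 0%R (cmat I) (s := enum 'I_rows) (t := enum 'I_cols).
by rewrite !size_enum_ord => -> //; rewrite !nth_ord_enum.
Qed.

Lemma nth_rhs (i : 'I_rows) : nth 0%R pip_rats (rows * cols + i) = rhs I i 0%R.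
Proof.
rewrite /pip_rats nth_cat size_allpairs !size_enum_ord ltnNge leq_addr addKn.
by rewrite nth_cat size_map size_enum_ord ltn_ord (nth_map i) ?size_enum_ord //
  nth_ord_enum.
Qed.

Lemma nth_obj (j : 'I_cols) :
  nth 0%R pip_rats (rows * cols + rows + j) = obj I 0%R j.
Proof.
rewrite /pip_rats nth_cat size_allpairs !size_enum_ord -addnA ltnNge leq_addr.
rewrite addKn nth_cat size_map size_enum_ord ltnNge leq_addr addKn.
by rewrite (nth_map j) ?size_enum_ord // nth_ord_enum.
Qed.

Lemma pip_rats_ge0 q : q \in pip_rats -> (0 <= q)%R.
Proof.
rewrite !mem_cat.
case/or3P=> [/allpairsP[[i j] [_ _ ->]]|/mapP[i _ ->]|/mapP[j _ ->]].
- exact: cmat_ge0.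
- exact: rhs_ge0.
- exact: obj_ge0.
Qed.

Definition coords (n : nat) (y : 'cV[nat]_n) : nat -> nat :=
  nth 0 (encode_solution y).

Lemma coordsE n (y : 'cV[nat]_n) (j : 'I_n) : coords y j = y j 0%R.
Proof. by rewrite /coords (nth_map j) ?size_enum_ord // nth_ord_enum. Qed.

Variable M : memory.
Hypothesis M_run : run_of (encode_pip I) tables M.
Local Notation m := (M tab_header 0).
Local Notation n := (M tab_header 1).
Local Notation mn := (M tab_num_entries 0).
Local Notation num_rats := (M tab_num_rats 0).
Local Notation D := (M tab_denom 0).
Local Notation P := (M tab_capacity 0).
Local Notation E := (fun i j => M tab_matrix (i * n + j)).
Local Notation u := (M tab_mult).
Local Notation c := (fun j => M tab_scaled (mn + m + j)).
Local Notation val i j := (M tab_scaled (i * n + j)).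
Local Notation rhs_row i := (2 * M tab_scaled (mn + i) + 1).
Local Notation ub j := (M tab_body (2 * num_rats + j)).

Lemma num_rowsE : m = rows.
Proof. by rewrite (tab_headerE M_run) encode_pipE. Qed.

Lemma num_colsE : n = cols.
Proof. by rewrite (tab_headerE M_run) encode_pipE. Qed.

Lemma num_entriesE : mn = rows * cols.
Proof. by rewrite (tab_num_entriesE M_run) num_rowsE num_colsE. Qed.

Lemma num_ratsE : num_rats = rows * cols + rows + cols.
Proof. by rewrite (tab_num_ratsE M_run) num_entriesE num_rowsE num_colsE. Qed.

Lemma body_nth x : x < 2 * num_rats + n -> M tab_body x = nth 0 pip_body x.
Proof.
move=> lt_x; rewrite (tab_bodyE M_run) (tab_body_sizeE M_run) lt_x encode_pipE.
by rewrite /= drop0.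
Qed.

Lemma body_rat x : x < num_rats ->
  M tab_body (2 * x) = `|numq (nth 0%R pip_rats x)|%N /\
  M tab_body (2 * x + 1) = `|denq (nth 0%R pip_rats x)|%N.
Proof.
rewrite num_ratsE => lt_x; rewrite !body_nth ?num_ratsE; try lia.
have [|<- <-] := @nth_flatten_rat pip_rats x; first by rewrite size_pip_rats.
by split; rewrite nth_cat size_flatten_rat size_pip_rats ifT //; lia.
Qed.

Lemma body_ubound (j : 'I_cols) : ub j = encode_ubound (ubound I j).
Proof.
rewrite body_nth ?ltn_add2l ?num_colsE // nth_cat size_flatten_rat.
rewrite size_pip_rats num_ratsE ltnNge leq_addr addKn.
by rewrite (nth_map j) ?size_enum_ord // nth_ord_enum.
Qed.

Lemma denom_gt0 : 0 < D.
Proof.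
rewrite (tab_denomE M_run) prodn_gt0 // => x.
by have [_ ->] := body_rat (ltn_ord x); rewrite absz_gt0.
Qed.

Lemma den_dvd_denom x : x < num_rats -> M tab_body (2 * x + 1) %| D.
Proof.
move=> lt_x; rewrite (tab_denomE M_run) (bigD1 (Ordinal lt_x)) //=.
exact: dvdn_mulr.
Qed.

Lemma scaledE x : x < num_rats ->
  ((M tab_scaled x)%:R = nth 0 pip_rats x * D%:R :> rat)%R.
Proof.
move=> lt_x; have [eq_num eq_den] := body_rat lt_x.
have := den_dvd_denom lt_x; rewrite (tab_scaledE M_run) // eq_num eq_den.
set q := nth _ _ _ => /dvdnP[d ->].
have q_ge0 : (0 <= q)%R.
  by apply/pip_rats_ge0/mem_nth; rewrite size_pip_rats -num_ratsE.
have den_gt0 : 0 < `|denq q|%N by rewrite absz_gt0.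
rewrite mulnK // -{2}[q]divq_num_den !natrM !natr_absz normr_denq.
rewrite ger0_norm ?numq_ge0 //.
have nz : ((denq q)%:~R != 0 :> rat)%R by rewrite intr_eq0.
by rewrite [(d%:R * _)%R]mulrC mulrA divfK.
Qed.

Lemma scaled_cmat (i : 'I_rows) (j : 'I_cols) :
  ((val i j)%:R = cmat I i j * D%:R :> rat)%R.
Proof.
rewrite num_colsE scaledE ?nth_cmat // num_ratsE.
by have := ltn_pair (ltn_ord i) (ltn_ord j); lia.
Qed.

Lemma scaled_rhs (i : 'I_rows) :
  ((M tab_scaled (mn + i)%N)%:R = rhs I i 0 * D%:R :> rat)%R.
Proof.
rewrite num_entriesE scaledE ?nth_rhs // num_ratsE.
by have := ltn_ord i; lia.
Qed.

Lemma scaled_obj (j : 'I_cols) : ((c j)%:R = obj I 0 j * D%:R :> rat)%R.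
Proof.
rewrite num_entriesE num_rowsE scaledE ?nth_obj // num_ratsE.
by have := ltn_ord j; lia.
Qed.

Lemma matrixE (i : 'I_rows) (j : 'I_cols) :
  E i j = 2 * val i j * (P %/ rhs_row i).
Proof.
rewrite num_colsE (tab_matrixE M_run) ?num_entriesE ?ltn_pair // num_colsE.
by rewrite divn_pair.
Qed.

Lemma matrix_gt0 (i : 'I_rows) (j : 'I_cols) :
  (0 < E i j) = (cmat I i j != 0%R).
Proof.
have scale_gt0 : 0 < P %/ rhs_row i.
  by apply: (row_scale_gt0 M_run); rewrite num_rowsE.
rewrite /= matrixE muln_gt0 scale_gt0 andbT muln_gt0 /= -(ltr_nat rat).
rewrite scaled_cmat pmulr_lgt0 ?ltr0n ?denom_gt0 // lt0r.
by case: eqP => //= _; apply: cmat_ge0.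
Qed.

Lemma sum_num_cols (F : nat -> nat) : \sum_(j < n) F j = \sum_(j < cols) F j.
Proof. by rewrite num_colsE. Qed.

(* [2 * s <= 2 * r] iff [2 * s <= 2 * r + 1] for integers: hence a row whose
   right-hand side [r] is 0 can be scaled too. *)
Lemma row_load_le (z : nat -> nat) (i : 'I_rows) :
  (row_load n E predT z i <= P) =
  (\sum_j cmat I i j * (z j)%:R <= rhs I i 0 :> rat)%R.
Proof.
have lt_i : i < m by rewrite num_rowsE.
pose S := \sum_(j < cols) val i j * z j.
have -> : row_load n E predT z i = 2 * S * (P %/ rhs_row i).
  rewrite /row_load (sum_num_cols (fun j => z j * E i j)) /S.
  rewrite big_distrr big_distrl.
  by apply: eq_bigr => j _; rewrite /= matrixE; nia.
rewrite -[X in _ <= X](divnK (rhs_dvd_capacity M_run lt_i)) [leqRHS]mulnC.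
rewrite leq_mul2r [_ %/ _ == 0]gtn_eqF ?(row_scale_gt0 M_run) //=.
rewrite -(ler_pM2r (_ : (0 < D%:R :> rat)%R)) ?ltr0n ?denom_gt0 //.
have -> : ((\sum_j cmat I i j * (z j)%:R) * D%:R = S%:R :> rat)%R.
  rewrite mulr_suml natr_sum; apply: eq_bigr => j _.
  by rewrite natrM scaled_cmat mulrAC.
by rewrite -scaled_rhs ler_nat; apply/idP/idP; lia.
Qed.

Lemma objectiveE (y : 'cV[nat]_cols) :
  ((\sum_(j < n) c j * coords y j)%N%:R = objective y * D%:R :> rat)%R.
Proof.
rewrite (sum_num_cols (fun j => c j * coords y j)) natr_sum /objective.
rewrite mulr_suml; apply: eq_bigr => j _.
by rewrite natrM coordsE scaled_obj mulrAC.
Qed.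

Lemma feasible_load (y : 'cV[nat]_cols) i : feasible y -> i < m ->
  row_load n E predT (coords y) i <= P.
Proof.
rewrite num_rowsE => -[fits_y _] lt_i; rewrite (row_load_le _ (Ordinal lt_i)).
by under eq_bigr => j _ do rewrite coordsE; apply: fits_y.
Qed.

Lemma feasible_le_div (y : 'cV[nat]_cols) j : feasible y -> j < n ->
  0 < M tab_col_max j -> coords y j <= P %/ M tab_col_max j.
Proof.
move=> feas_y lt_j em_gt0.
rewrite leq_divRL // (tab_col_maxE M_run) // /col_max.
have [->|y_gt0] := posnP (coords y j); first by rewrite mul0n.
rewrite mulnC -leq_divRL //; apply/bigmax_leqP => i _.
rewrite leq_divRL // mulnC.
apply: leq_trans (feasible_load feas_y (ltn_ord i)).
exact: (leq_row_load_term E (p := predT)).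
Qed.

Lemma feasible_le_ubound (y : 'cV[nat]_cols) j : feasible y -> j < n ->
  0 < ub j -> coords y j <= ub j - 1.
Proof.
rewrite num_colsE => -[_ le_y] lt_j; have := body_ubound (Ordinal lt_j).
have := le_y (Ordinal lt_j); rewrite -coordsE /= => + ->.
by case: (ubound I _) => //= d; lia.
Qed.

(* [tab_mult] is 0 on the columns without entries and without upper bound; they
   make the program unbounded, unless their cost is 0. *)
Definition is_free (j : nat) : bool := (M tab_col_max j == 0) && (ub j == 0).

Lemma feasible_le_mult (y : 'cV[nat]_cols) j :
  feasible y -> j < n -> ~~ is_free j -> coords y j <= u j.
Proof.
move=> feas_y lt_j; rewrite /is_free (tab_multE M_run) //.
have := feasible_le_div feas_y lt_j; have := feasible_le_ubound feas_y lt_j.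
case: (M tab_col_max j) => [|e];
  case: (M tab_body _) => [|d] //= le_ub le_div _;
  by rewrite ?mul0n ?mul1n ?addn0 ?add0n; have := le_div; have := le_ub; lia.
Qed.

Lemma free_cmat (i : 'I_rows) (j : 'I_cols) : is_free j -> cmat I i j = 0%R.
Proof.
case/andP=> /eqP em0 _; apply/eqP; rewrite -[_ == _]negbK -matrix_gt0 -leqNgt.
have lt_i : i < m by rewrite num_rowsE.
have lt_j : j < n by rewrite num_colsE.
by have := matrix_le_col_max M_run lt_i lt_j; rewrite em0.
Qed.

Lemma feasible_increment (y : 'cV[nat]_cols) (j : 'I_cols) :
  feasible y -> is_free j -> feasible (\col_l (y l 0%R + (l == j))%N)%R.
Proof.
move=> [fits_y le_y] free_j; split=> [i|l].
  apply: le_trans (fits_y i); rewrite le_eqVlt; apply/orP; left; apply/eqP.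
  apply: eq_bigr => l _; rewrite mxE; have [->|] := eqVneq l j;
    last by rewrite addn0.
  by rewrite free_cmat // !mul0r.
have := le_y l; rewrite mxE; have [->|] := eqVneq l j; last by rewrite addn0.
by have /andP[_] := free_j; rewrite body_ubound; case: (ubound I j).
Qed.

Lemma optimal_free_obj (y : 'cV[nat]_cols) j :
  optimal y -> j < n -> is_free j -> c j = 0.
Proof.
rewrite num_colsE => -[feas_y opt_y] lt_j free_j; pose j' := Ordinal lt_j.
apply/eqP; rewrite -(eqr_nat rat) (scaled_obj j') mulf_eq0; apply/orP; left.
have := opt_y _ (feasible_increment (j := j') feas_y free_j).
have -> : objective (\col_l (y l 0%R + (l == j'))%N)%R =
    (objective y + obj I 0 j')%R.
  rewrite /objective (bigD1 j') // [X in (_ = X + _)%R](bigD1 j') //= mxE eqxx.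
  rewrite natrD mulrDr mulr1 addrAC; congr (_ + _ + _)%R.
  by apply: eq_bigr => l neq_l; rewrite mxE (negPf neq_l) addn0.
by rewrite gerDl => le0; apply/eqP/le_anti; rewrite le0 obj_ge0.
Qed.

Definition output_vector : 'cV[nat]_cols := (\col_j M tab_output j)%R.

Lemma output_vectorE : mkseq (M tab_output) n = encode_solution output_vector.
Proof.
rewrite num_colsE /mkseq -val_enum_ord -map_comp /encode_solution.
by apply: eq_map => j; rewrite mxE.
Qed.

Lemma output_feasible : feasible output_vector.
Proof.
split=> [i|j].
  have lt_i : i < m by rewrite num_rowsE.
  have := output_load M_run lt_i; rewrite (row_load_le _ i).
  by congr (_ <= _)%R; apply: eq_bigr => j _; rewrite mxE.
have lt_j : j < n by rewrite num_colsE.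
have := output_le_mult M_run lt_j; rewrite (tab_multE M_run) // body_ubound mxE.
case: (ubound I j) => //= d /leq_trans; apply; rewrite mul0n mul1n add0n subn1.
by case: (M tab_col_max j) => [|e]; rewrite /= ?mul0n ?mul1n ?addn0 ?leq_subr.
Qed.

Lemma output_approx_optimal k (y : 'cV[nat]_cols) :
  column_sparse k I -> optimal y ->
  \sum_(j < n) c j * coords y j <=
  (2 * k ^ 2 + 2) * \sum_(j < n) c j * coords output_vector j.
Proof.
move=> sparse opt_y; have [feas_y _] := opt_y.
pose z j := if is_free j then 0 else coords y j.
have z_le_y j : z j <= coords y j by rewrite /z; case: ifP.
have support_le j : j < n -> #|col_support m E j| <= k.
  move=> lt_j; have lt_jI : j < cols by rewrite -num_colsE.
  rewrite num_rowsE; apply: leq_trans (sparse (Ordinal lt_jI)).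
  apply/subset_leq_card/subsetP => i; rewrite !inE.
  by rewrite -(matrix_gt0 i (Ordinal lt_jI)).
have z_le_u j : j < n -> z j <= u j.
  move=> lt_j; rewrite /z; case: ifPn => // not_free.
  exact: feasible_le_mult.
have z_load i : i < m -> row_load n E predT z i <= P.
  by move=> lt_i; apply: leq_trans (feasible_load feas_y lt_i);
    apply: leq_row_load.
have -> : \sum_(j < n) c j * coords y j = \sum_(j < n) c j * z j.
  apply: eq_bigr => j _; rewrite /z; case: ifP => // free_j.
  by rewrite (optimal_free_obj opt_y (ltn_ord j) free_j).
have -> : \sum_(j < n) c j * coords output_vector j =
    \sum_(j < n) c j * M tab_output j.
  rewrite (sum_num_cols (fun j => c j * coords output_vector j)).
  rewrite (sum_num_cols (fun j => c j * M tab_output j)).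
  by apply: eq_bigr => j _; rewrite coordsE mxE.
by have := output_approx M_run z_le_u z_load support_le.
Qed.

Lemma output_approx_solution k : column_sparse k I ->
  approx_solution (2 * k%:R ^+ 2 + 2)%R output_vector.
Proof.
move=> sparse; split=> [|y opt_y]; first exact: output_feasible.
have alpha_gt0 : (0 < 2 * k%:R ^+ 2 + 2 :> rat)%R.
  by rewrite ltr_wpDl // mulr_ge0 // exprn_ge0 ?ler0n.
rewrite mulrC ler_pdivrMr // -(ler_pM2r (_ : (0 < D%:R :> rat)%R)); last first.
  by rewrite ltr0n denom_gt0.
rewrite mulrAC -!objectiveE.
have -> : (2 * k%:R ^+ 2 + 2 = (2 * k ^ 2 + 2)%N%:R :> rat)%R.
  by rewrite natrD natrM natrX.
by rewrite -natrM ler_nat mulnC output_approx_optimal.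
Qed.

End Encoding.

(** * Polynomial time *)

Section Sizes.
Variables (I : pip) (M : memory).
Hypothesis M_run : run_of (encode_pip I) tables M.
Local Notation rows := (nrows I).
Local Notation cols := (ncols I).
Local Notation L := (word_size (encode_pip I)).

Lemma num_rats_le : rows * cols + rows + cols <= L.
Proof.
apply: leq_trans (size_le_word_size _); rewrite encode_pipE /= size_cat.
by rewrite size_flatten_rat size_pip_rats; lia.
Qed.

Lemma classes_le : M tab_classes 0 <= L.+1.
Proof.
have le_L := num_rats_le; rewrite (tab_classesE M_run) geq_max /=.
apply/bigmax_leqP => j _; apply: leq_trans (max_card _) _.
by rewrite card_ord (num_rowsE M_run); lia.
Qed.

Lemma loops_bounded : bounded_by (L.+2 ^ 3) M (num_cols :: prog_bounds tables).
Proof.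
have le_L := num_rats_le; have le_K := classes_le.
have def_cube : L.+2 ^ 3 = L.+2 * (L.+2 * L.+2) by rewrite !expnS expn0 muln1.
have le_nn : cols * cols <= L * L by rewrite leq_mul; lia.
have le_nK : cols * M tab_classes 0 <= L * L.+1 by rewrite leq_mul; lia.
have /allP sizes_le : all (leq^~ (L.+2 ^ 3))
    [:: 1; 2; M tab_header 0; M tab_header 1; M tab_num_entries 0;
        M tab_num_rats 0; M tab_body_size 0; M tab_num_pairs 0;
        M tab_num_residuals 0; M tab_classes 0; M tab_num_shares 0].
  rewrite (tab_body_sizeE M_run) (tab_num_residualsE M_run).
  rewrite (tab_num_pairsE M_run) (tab_num_sharesE M_run) (num_ratsE M_run).
  rewrite (num_entriesE M_run) (num_rowsE M_run) (num_colsE M_run) def_cube.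
  by rewrite /=; do !(apply/andP; split); nia.
rewrite /bounded_by [prog_bounds _]/= [all _ _]/=.
by rewrite !sizes_le // !inE eqxx ?orbT.
Qed.

End Sizes.

Definition poly_bits (a : nat) : Prop :=
  exists d, forall I M, run_of (encode_pip I) tables M ->
    forall i, bitlen (M a i) <= (word_size (encode_pip I)).+2 ^ d.

Lemma poly_bits_uniform N : (forall a, a < N -> poly_bits a) ->
  exists d, forall I M, run_of (encode_pip I) tables M ->
    forall a i, a < N -> bitlen (M a i) <= (word_size (encode_pip I)).+2 ^ d.
Proof.
elim: N => [|N IH] bits; first by exists 0.
have [a lt_a|d1 le1] := IH; first by apply: bits; apply: ltnW.
have [d2 le2] := bits N (ltnSn N); exists (d1 + d2) => I M M_run a i.
rewrite ltnS leq_eqVlt => /predU1P[->|lt_a].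
  by apply: leq_trans (le2 _ _ M_run i) _; rewrite leq_pexp2l ?leq_addl.
by apply: leq_trans (le1 _ _ M_run a i lt_a) _; rewrite leq_pexp2l ?leq_addr.
Qed.

Lemma word_size_unread st w i : word_size (unread st w i) <= word_size w.
Proof.
case: st => //= _; rewrite -{2}(cat_take_drop i w) /word_size big_cat /=.
exact: leq_addl.
Qed.

Lemma word_size_run a g w ss : word_size (run a g w ss).2 <= word_size w.
Proof.
elim: ss a g w => //= st ss IH a g w.
exact: leq_trans (IH _ _ _) (word_size_unread _ _ _).
Qed.

Lemma stmt_bounded ss a b M : a < size ss -> bounded_by b M (prog_bounds ss) ->
  bounded_by b M (stmt_bounds (nth (Input (Fixed 0)) ss a)).
Proof.
elim: ss a => // st ss IH [|a] lt_a; rewrite /prog_bounds /= bounded_by_cat.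
  by case/andP.
by case/andP=> _ /IH; apply.
Qed.

(* The residuals are the only table whose entries grow along the recursion. *)
Definition reads_back (a : nat) : bool :=
  match nth (Input (Fixed 0)) tables a with
  | Input _ => true
  | Table _ e => (a == tab_residual) || all (ltn^~ a) (size_reads e)
  end.

Lemma tables_read_back a : a < size tables -> reads_back a.
Proof.
have /allP back : all reads_back (iota 0 (size tables)) by vm_compute.
by move=> lt_a; apply: back; rewrite mem_iota.
Qed.

Lemma table_bounds I M a : run_of (encode_pip I) tables M -> a < size tables ->
  let b := (word_size (encode_pip I)).+2 ^ 3 in
  let st := nth (Input (Fixed 0)) tables a in
  eval_bound (visible M a 0) (stmt_bound st) <= b /\
  bounded_by b M (stmt_bounds st).
Proof.
move=> M_run lt_a b st; have /andP[_ bounds] := loops_bounded M_run.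
have bounds_st := stmt_bounded lt_a bounds; split=> //.
apply: leq_trans (eval_bound_le _ (visible_le M a 0)) _.
by move: bounds_st; rewrite -/st; case: (st) => [B|B e] /andP[].
Qed.

(* Each step multiplies the residuals by at most [P * K]. *)
Lemma bitlen_residual w M b x : run_of w tables M ->
  (forall a i, a < tab_residual -> bitlen (M a i) <= b) ->
  x < M tab_num_residuals 0 -> bitlen (M tab_residual x) <= b + x * (b * 2).
Proof.
move=> M_run le_b; elim/ltn_ind: x => x IH lt_x.
rewrite (tab_residualE M_run) //.
set n := M tab_header 1; have [q0|q_gt0] := posnP (x %/ n).
  rewrite q0 subn0 subnn mul0n addn0 mul1n; apply: leq_trans (leq_addr _ _).
  have := le_b tab_scaled (M tab_num_entries 0 + M tab_header 0 + x) isT.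
  by apply: leq_trans; apply: leq_bitlen; case: (M tab_mult x); lia.
have n_gt0 : 0 < n by move: q_gt0; case: (n).
have le_n : n <= x by rewrite -divn_gt0.
have -> : 1 - x %/ n = 0 by lia.
have lt_xn : x - n < x by lia.
rewrite mul0n add0n subn0 mul1n lt_xn mul1n.
apply: leq_trans (leq_bitlen (leq_subr _ _)) _.
apply: leq_trans (bitlenM _ _) _.
have := bitlenM (M tab_capacity 0) (M tab_classes 0).
have := le_b tab_capacity 0 isT; have := le_b tab_classes 0 isT.
have := IH (x - n) lt_xn (ltn_trans lt_xn lt_x).
have : (x - n).+1 * (b * 2) <= x * (b * 2) by rewrite leq_mul2r lt_xn orbT.
by rewrite mulSn; lia.
Qed.

Lemma poly_bits_residual : (forall a, a < tab_residual -> poly_bits a) ->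
  poly_bits tab_residual.
Proof.
case/poly_bits_uniform => d le_d.
have [|d' le_d'] := @poly_bounded_exp (fun b => b + b * (b * 2)) (d + 2).
  by poly_bounded_tac.
exists d' => I M M_run x; apply: leq_trans (le_d' _); rewrite -addnS.
set L := word_size _; set b := L.+2 ^ _.
have [lt_x|le_x] := ltnP x (M tab_num_residuals 0); last first.
  rewrite (table_default (a := tab_residual) M_run erefl isT le_x).
  by apply: leq_trans (leq_addr _ _); rewrite expn_gt0.
apply: leq_trans (bitlen_residual M_run (b := b) _ lt_x) _ => [a i lt_a|].
  by apply: leq_trans (le_d _ _ M_run a i lt_a) _; rewrite leq_pexp2l ?leq_addr.
rewrite leq_add2l leq_mul2r; apply/orP; right; apply: leq_trans (ltnW lt_x) _.
have [le_size _] := table_bounds M_run (isT : tab_residual < size tables).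
by apply: leq_trans le_size _; rewrite leq_pexp2l ?leq_addl.
Qed.

Lemma bitlen_input I M a i B : run_of (encode_pip I) tables M ->
  a < size tables ->
  nth (Input (Fixed 0)) tables a = Input B ->
  bitlen (M a i) <= (word_size (encode_pip I)).+1.
Proof.
move=> M_run lt_a eq_st; rewrite (input_entry M_run i eq_st lt_a).
case: ifP => // _; apply: word_bits_le_nth => //.
apply: sub_all (word_bits_le_word_size _) => v /leq_trans; apply; apply: leqW.
exact: word_size_run.
Qed.

Lemma poly_bits_all a : a < size tables -> poly_bits a.
Proof.
elim/ltn_ind: a => a IH lt_a; have [eq_R|neq_R] := eqVneq a tab_residual.
  rewrite eq_R in IH *; apply: poly_bits_residual => a' lt_a'.
  by apply: IH => //; apply: ltn_trans lt_a' _.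
have := tables_read_back lt_a; rewrite /reads_back (negPf neq_R).
case eq_st : (nth _ _ _) => [B|B e] /=.
  move=> _; exists 1 => I M M_run i; rewrite expn1.
  exact: leqW (bitlen_input i M_run lt_a eq_st).
move/allP=> lt_reads.
have [a' lt_a'|D le_D] := @poly_bits_uniform a.
  by apply: IH => //; apply: ltn_trans lt_a' lt_a.
have poly_e := poly_bounded_value_bits e.
have [|d le_d] := @poly_bounded_exp (fun b => value_bits b e + 1) (D + 2).
  by poly_bounded_tac.
exists d => I M M_run i; apply: leq_trans (le_d _); rewrite -addnS.
set L := word_size _; set b := L.+2 ^ _; have b_gt0 : 0 < b by rewrite expn_gt0.
have [le_B bounds] := table_bounds M_run lt_a; rewrite eq_st /= in le_B bounds.
have le_b : L.+2 ^ 3 <= b by rewrite leq_pexp2l ?leq_addl.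
have [lt_i|le_i] := ltnP i (eval_bound (visible M a 0) B); last first.
  by rewrite (table_default M_run eq_st lt_a le_i) leq_addl.
rewrite (table_entry M_run eq_st lt_a lt_i); apply: leq_trans (leq_addr _ _).
apply: bitlen_eval => //.
- move=> a' i' a'_e; apply: leq_trans (leq_bitlen (visible_le M a i a' i')) _.
  apply: leq_trans (le_D _ _ M_run _ _ (lt_reads _ a'_e)) _.
  by rewrite leq_pexp2l ?leq_addr.
- apply: bounded_by_le (visible_le M a i) _; have /andP[_] := bounds.
  by apply: sub_all => B' /leq_trans; apply.
- rewrite /= andbT; apply: leq_trans (bitlen_ltn lt_i) _.
  exact: leq_trans le_B le_b.
Qed.

Lemma solver_correct : exists d, forall I M, run_of (encode_pip I) tables M ->
  exists2 t, t <= (word_size (encode_pip I)).+2 ^ d &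
    outputs_in solver (encode_pip I) t (encode_solution (output_vector I M)).
Proof.
have [D le_D] := poly_bits_uniform poly_bits_all.
have [d le_d] :=
  poly_bounded_exp (D + 2) (poly_bounded_compile_time tables num_cols).
exists d => I M M_run; rewrite -(output_vectorE M_run).
set w := encode_pip I; set b := (word_size w).+2 ^ (D + 2).+1.
have M_bits : memory_bits_le b M.
  move=> a i; have [lt_a|le_a] := ltnP a (size tables).
    apply: leq_trans (le_D _ _ M_run a i lt_a) _.
    by rewrite leq_pexp2l // -addnS leq_addr.
  by rewrite (run_ofE M_run) run_after // /b expn_gt0.
have M_bounds : bounded_by b M (num_cols :: prog_bounds tables).
  apply: sub_all (loops_bounded M_run) => B /leq_trans; apply.
  by rewrite leq_pexp2l // -addnS leq_addl.
have b_gt0 : 0 < b by rewrite expn_gt0.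
have := @compile_correct tables num_cols b w.
rewrite -(run_ofE M_run) =>
  /(_ b_gt0 isT tables_wf isT M_bits M_bounds)[t le_t out_t].
by exists t => //; apply: leq_trans le_t (le_d _).
Qed.

Local Open Scope ring_scope.

Theorem theorem2 :
  exists alg : program,
    polynomial_time alg pip_word /\
    forall (k : nat) (I : pip), column_sparse k I ->
      exists x : 'cV[nat]_(ncols I),
        outputs alg (encode_pip I) (encode_solution x) /\
        approx_solution (2 * k%:R ^+ 2 + 2) x.
Proof.
have [d spec] := solver_correct.
pose x I := output_vector I (run 0 blank (encode_pip I) tables).1.
exists solver; split.
  exists (('X + 2%:P) ^+ d) => w [I ->].
  have [t le_t out_t] := spec I _ (RunOf _ _).
  exists t, (encode_solution (x I)); split=> //.
  by apply: leq_trans le_t _; rewrite horner_exp hornerD hornerX hornerC -addn2.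
move=> k I sparse; have [t _ out_t] := spec I _ (RunOf _ _).
exists (x I); split; first by exists t.
exact: (output_approx_solution (RunOf _ _) sparse).
Qed.
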